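(* Consider the edge adapter caching-and-routing problem and the algorithm POLAR described in the context. Assume $\|\theta_a^\star\|_2\le 1$ for all $a$, $\|x_t\|_2\le 1$ for all $t$ (the context sequence is otherwise arbitrary), the noise $\eta_t(a)$ is conditionally $\sigma$-sub-Gaussian, the ridge parameter satisfies $\lambda\ge 1$, and the cold-path penalties satisfy $\lambda_a\in(0,\lambda_{\max}]$. Then, with probability at least $1-\delta$, POLAR satisfies $$\mathrm{Regret}(T)\le 2\beta_T\sqrt{2NdT\log\Bigl(1+\frac{T}{d\lambda}\Bigr)}+\alpha\lambda_{\max}T+\Bigl\lceil \frac{T}{H}\Bigr\rceil K\gamma .$$
   Context: Problem. There is a library $\mathcal{M}=\{1,\dots,N\}$ of adapters and a cache size $1\le K\le N$. Rounds are $t=1,\dots,T$; at round $t$ a context $x_t\in\mathbb{R}^d$ is observed. Each adapter $a$ has an unknown parameter $\theta_a^\star\in\mathbb{R}^d$ and a known cold-path penalty $\lambda_a>0$; $\lambda_{\max}:=\max_a\lambda_a$. If adapter $a_t$ is selected at round $t$, only the quality $q_t(a_t)=\langle\theta_{a_t}^\star,x_t\rangle+\eta_t(a_t)$ is observed, where $\eta_t(a)$ is conditionally $\sigma$-sub-Gaussian given $x_t$ and the past. Fixed parameters are $\alpha>0$ (latency weight) and $\gamma>0$ (switching cost). Time is divided into epochs; a resident set (cache) $C_\ell\subseteq\mathcal{M}$ with $|C_\ell|\le K$ is fixed during epoch $\ell$, and $\ell(t)$ denotes the epoch containing round $t$. Define $\mu_t(a;C):=\langle\theta_a^\star,x_t\rangle-\alpha\lambda_a\mathbf{1}\{a\notin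 C\}$ and $$\mathrm{Regret}(T):=\max_{|C|=K}\sum_{t=1}^T\max_{a\in\mathcal{M}}\mu_t(a;C)-\Bigl[\sum_{t=1}^T\mu_t(a_t;C_{\ell(t)})-\sum_{\ell\ge 2}\gamma|C_\ell\setminus C_{\ell-1}|\Bigr].$$ Router quantities. With ridge parameter $\lambda>0$ and failure level $\delta\in(0,1)$: $V_{a,t}:=\lambda I_d+\sum_{s<t}\mathbf{1}\{a_s=a\}x_sx_s^\top$, $\hat\theta_{a,t}:=V_{a,t}^{-1}\sum_{s<t}\mathbf{1}\{a_s=a\}q_s(a)x_s$, $s_{a,t}:=\sqrt{x_t^\top V_{a,t}^{-1}x_t}$, and $\beta_t:=\sigma\sqrt{d\log(1+\tfrac{t}{d\lambda})+2\log\tfrac{N}{\delta}}+\sqrt{\lambda}$. The cache-aware score is $\mathrm{score}_t(a):=\langle\hat\theta_{a,t},x_t\rangle+\beta_t s_{a,t}-\alpha\lambda_a\mathbf{1}\{a\notin C_{\ell(t)}\}$. Algorithm POLAR (epoch length $H$). Epoch $\ell=1,\dots,\lceil T/H\rceil$ consists of rounds $(\ell-1)H+1,\dots,\min\{\ell H,T\}$. $C_1$ is any set with $|C_1|\le K$. For $\ell>1$, $C_\ell$ is computed by the greedy update below from $C_{\ell-1}$, the current estimates, and the contexts of epoch $\ell-1$, and the switching cost $\gamma|C_\ell\setminus C_{\ell-1}|$ is paid. In each round of epoch $\ell$, the algorithm observes $x_t$, plays $a_t\in\arg\max_a\mathrm{score}_t(a)$, observes $q_t(a_t)$ and updates the ridge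 statistics of $a_t$. Greedy update: for each context $x_t$ of the previous epoch let $\mathrm{UCB}_t(a):=\langle\hat\theta_a,x_t\rangle+\beta_t\sqrt{x_t^\top V_a^{-1}x_t}$ (current estimates), $b_t:=\max_a(\mathrm{UCB}_t(a)-\alpha\lambda_a)$, $\Delta_t(a):=\max\{0,\mathrm{UCB}_t(a)-b_t\}$; start with $C=\emptyset$, $\mathrm{best}_t=0$; up to $K$ times, compute $g(a)=\sum_t\max\{0,\Delta_t(a)-\mathrm{best}_t\}-\gamma\mathbf{1}\{a\notin C_{\ell-1}\}$ for $a\notin C$, take $a^\star\in\arg\max g$, stop if $g(a^\star)\le 0$, else add $a^\star$ to $C$ and update $\mathrm{best}_t$ to $\max\{\mathrm{best}_t,\Delta_t(a^\star)\}$; return $C$. *)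

(* Defs.v *)
From HB Require Import structures.
From mathcomp Require Import all_boot all_order all_algebra.
From mathcomp Require Import all_classical all_reals all_analysis.
Set Implicit Arguments.
Unset Strict Implicit.
Unset Printing Implicit Defensive.
Import Order.TTheory GRing.Theory Num.Theory.
Local Open Scope ring_scope.

Section Polar.
Variable R : realType.

Definition dotv (d : nat) (u v : 'cV[R]_d) : R := (u^T *m v) 0 0.

(* Maximum of F over a finite collective predicate A (meaningful when A is
   nonempty; the default seed is a value F x with x in A). *)
Definition fmax (T : finType) (A : {pred T}) (F : T -> R) : R :=
  \big[Num.max/(if [pick x in A] is Some x then F x else 0)]_(x in A) F x.

(* Epoch containing round t >= 1 (epochs of length H, numbered from 1). *)
Definition epoch (H t : nat) : nat := (t.-1 %/ H).+1.

Definition nepochs (T H : nat) : nat := (T + H.-1) %/ H.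

Variables (d N : nat).

Definition mu (theta : 'I_N -> 'cV[R]_d) (lam : 'I_N -> R) (alpha : R)
  (x : 'cV[R]_d) (a : 'I_N) (C : {set 'I_N}) : R :=
  dotv (theta a) x - alpha * lam a * (a \notin C)%:R.

Definition regret (theta : 'I_N -> 'cV[R]_d) (lam : 'I_N -> R)
  (alpha gamma : R) (K T H : nat)
  (x : nat -> 'cV[R]_d) (a : nat -> 'I_N) (C : nat -> {set 'I_N}) : R :=
  fmax [pred C0 : {set 'I_N} | #|C0| == K]
       (fun C0 => \sum_(1 <= t < T.+1) fmax predT (fun b => mu theta lam alpha (x t) b C0))
  - (\sum_(1 <= t < T.+1) mu theta lam alpha (x t) (a t) (C (epoch H t))
     - \sum_(2 <= l < (nepochs T H).+1) gamma * #|C l :\: C l.-1|%:R).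

Definition qobs (theta : 'I_N -> 'cV[R]_d) (x : nat -> 'cV[R]_d)
  (eta : nat -> 'I_N -> R) (a : nat -> 'I_N) (t : nat) : R :=
  dotv (theta (a t)) (x t) + eta t (a t).

Definition Vmat (ridge : R) (x : nat -> 'cV[R]_d) (act : nat -> 'I_N)
  (b : 'I_N) (t : nat) : 'M[R]_d :=
  ridge%:M + \sum_(1 <= s < t | act s == b) (x s *m (x s)^T).

Definition bvec (x : nat -> 'cV[R]_d) (q : nat -> R) (act : nat -> 'I_N)
  (b : 'I_N) (t : nat) : 'cV[R]_d :=
  \sum_(1 <= s < t | act s == b) (q s *: x s).

Definition thetahat (ridge : R) (x : nat -> 'cV[R]_d) (q : nat -> R)
  (act : nat -> 'I_N) (b : 'I_N) (t : nat) : 'cV[R]_d :=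
  invmx (Vmat ridge x act b t) *m bvec x q act b t.

Definition wnorm (V : 'M[R]_d) (y : 'cV[R]_d) : R :=
  Num.sqrt (dotv y (invmx V *m y)).

Definition beta (sigma ridge delta : R) (t : nat) : R :=
  sigma * Num.sqrt (d%:R * ln (1 + t%:R / (d%:R * ridge)) + 2 * ln (N%:R / delta))
  + Num.sqrt ridge.

Definition score (sigma ridge delta alpha : R) (lam : 'I_N -> R) (H : nat)
  (x : nat -> 'cV[R]_d) (q : nat -> R) (act : nat -> 'I_N)
  (C : nat -> {set 'I_N}) (t : nat) (b : 'I_N) : R :=
  dotv (thetahat ridge x q act b t) (x t)
  + beta sigma ridge delta t * wnorm (Vmat ridge x act b t) (x t)
  - alpha * lam b * (b \notin C (epoch H t))%:R.

(* Greedy update.  [greedy_spec ts Delta prev gamma k Ccur best out]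
   says: running the greedy loop with at most k remaining iterations from the
   current set Ccur and current best_t values, the loop may return out
   (argmax ties are broken arbitrarily). *)
Definition ggain (ts : seq nat) (Delta : nat -> 'I_N -> R) (prev : {set 'I_N})
  (gamma : R) (best : nat -> R) (b : 'I_N) : R :=
  \sum_(t <- ts) Num.max 0 (Delta t b - best t) - gamma * (b \notin prev)%:R.

Fixpoint greedy_spec (ts : seq nat) (Delta : nat -> 'I_N -> R)
  (prev : {set 'I_N}) (gamma : R) (k : nat) (Ccur : {set 'I_N})
  (best : nat -> R) (out : {set 'I_N}) : Prop :=
  match k with
  | 0 => out = Ccur
  | k'.+1 =>
      ((forall b, b \notin Ccur -> ggain ts Delta prev gamma best b <= 0)
        /\ out = Ccur)
      \/ (exists a0 : 'I_N,
            [/\ a0 \notin Ccur,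
                (forall b, b \notin Ccur ->
                   ggain ts Delta prev gamma best b
                   <= ggain ts Delta prev gamma best a0),
                0 < ggain ts Delta prev gamma best a0
              & greedy_spec ts Delta prev gamma k' (a0 |: Ccur)
                  (fun t => Num.max (best t) (Delta t a0)) out])
  end.

(* The greedy cache update producing C_l (l > 1) from C_{l-1}, the estimates
   current at the start of epoch l (round t0 = (l-1)H+1), and the contexts of
   epoch l-1 (rounds (l-2)H+1 .. (l-1)H). *)
Definition greedy_update (sigma ridge delta alpha gamma : R) (lam : 'I_N -> R)
  (K H : nat) (x : nat -> 'cV[R]_d) (q : nat -> R) (act : nat -> 'I_N)
  (prev : {set 'I_N}) (l : nat) (out : {set 'I_N}) : Prop :=
  let t0 := (l.-1 * H).+1 in
  let ts := iota ((l.-2 * H).+1) H in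
  let UCB := fun t b => dotv (thetahat ridge x q act b t0) (x t)
                        + beta sigma ridge delta t * wnorm (Vmat ridge x act b t0) (x t) in
  let bt := fun t => fmax predT (fun b => UCB t b - alpha * lam b) in
  let Delta := fun t b => Num.max 0 (UCB t b - bt t) in
  greedy_spec ts Delta prev gamma K finset.set0 (fun _ => 0) out.

End Polar.

Section History.
Local Open Scope classical_set_scope.
Variables (R : realType) (d : nat) (dO : measure_display) (Omega : measurableType dO).

Definition hist_gen (x : nat -> Omega -> 'cV[R]_d) (q : nat -> Omega -> R)
  (t : nat) : set (set Omega) :=
  [set A | (exists s (i : 'I_d) (B : set R),
              [/\ (1 <= s <= t)%N, measurable B & A = (fun w => x s w i 0) @^-1` B])
        \/ (exists s (B : set R),
              [/\ (1 <= s < t)%N, measurable B & A = q s @^-1` B])].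

Definition hist (x : nat -> Omega -> 'cV[R]_d) (q : nat -> Omega -> R)
  (t : nat) : set (set Omega) := <<s hist_gen x q t >>.
End History.

(* Main.v *)
(* Optimism reduces the regret of a round to twice the confidence width of the
   played adapter plus the cold-path penalty, as soon as every ridge estimate
   stays in its confidence ellipsoid; the widths are summed adapter by adapter
   with log det V = sum of log (1 + width^2) and det V <= (tr V / d)^d.  The
   greedy updates only matter through |C_l| <= K, which bounds the switching
   cost.

   The ellipsoids come from the supermartingale exp (S' V^-1 S / 2 sigma^2) /
   sqrt (det V / ridge^d), where S is the sum of the noises times the contexts.
   No Gaussian integral over R^d is needed: the rank-one updates of V^-1 and
   det V show that the one-step ratio is a one-dimensional Gaussian mixture of
   exp (z e - z^2 / 2) in the normalised noise e, with mean and variance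
   depending on the past only.  Ville's inequality then makes the bound uniform
   in time, and a union bound covers the N adapters. *)

Require Import Defs.
From HB Require Import structures.
From mathcomp Require Import all_boot all_order all_algebra.
From mathcomp Require Import all_classical all_reals all_analysis.
From mathcomp Require Import finmap measurable_realfun.
From mathcomp Require Import ring lra.
Import Order.TTheory GRing.Theory Num.Theory.
Local Open Scope classical_set_scope.
Local Open Scope ring_scope.
Set Implicit Arguments.
Unset Strict Implicit.
Unset Printing Implicit Defensive.

(** * Positive definite matrices *)

Section PosDef.
Variable R : realType.
Implicit Types d : nat.

Lemma dotvE d (u v : 'cV[R]_d) : dotv u v = \sum_i u i 0 * v i 0.
Proof. by rewrite /dotv mxE; apply: eq_bigr => i _; rewrite mxE. Qed.

Lemma dotvC d (u v : 'cV[R]_d) : dotv u v = dotv v u.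
Proof. by rewrite !dotvE; apply: eq_bigr => i _; rewrite mulrC. Qed.

Lemma dotvDr d (u v w : 'cV[R]_d) : dotv u (v + w) = dotv u v + dotv u w.
Proof. by rewrite /dotv mulmxDr mxE. Qed.

Lemma dotvDl d (u v w : 'cV[R]_d) : dotv (v + w) u = dotv v u + dotv w u.
Proof. by rewrite dotvC dotvDr !(dotvC u). Qed.

Lemma dotvZr d c (u v : 'cV[R]_d) : dotv u (c *: v) = c * dotv u v.
Proof. by rewrite /dotv -scalemxAr mxE. Qed.

Lemma dotvZl d c (u v : 'cV[R]_d) : dotv (c *: u) v = c * dotv u v.
Proof. by rewrite dotvC dotvZr dotvC. Qed.

Lemma dotvNr d (u v : 'cV[R]_d) : dotv u (- v) = - dotv u v.
Proof. by rewrite -scaleN1r dotvZr mulN1r. Qed.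

Lemma dotvBr d (u v w : 'cV[R]_d) : dotv u (v - w) = dotv u v - dotv u w.
Proof. by rewrite dotvDr dotvNr. Qed.

Lemma dotvBl d (u v w : 'cV[R]_d) : dotv (v - w) u = dotv v u - dotv w u.
Proof. by rewrite dotvC dotvBr !(dotvC u). Qed.

Lemma dotv0r d (u : 'cV[R]_d) : dotv u 0 = 0.
Proof. by rewrite /dotv mulmx0 mxE. Qed.

Lemma dotv_trmx d (A : 'M[R]_d) u v : dotv u (A *m v) = dotv (A^T *m u) v.
Proof. by rewrite /dotv trmx_mul trmxK mulmxA. Qed.

Lemma dotv_ge0 d (u : 'cV[R]_d) : 0 <= dotv u u.
Proof. by rewrite dotvE sumr_ge0 // => i _; rewrite -expr2 sqr_ge0. Qed.

Lemma dotv_gt0 d (u : 'cV[R]_d) : u != 0 -> 0 < dotv u u.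
Proof.
move=> u0; rewrite lt_def dotv_ge0 andbT; apply: contraNneq u0 => /eqP.
rewrite dotvE psumr_eq0; last by move=> i _; rewrite -expr2 sqr_ge0.
move=> /allP u0; apply/eqP/matrixP => i j; rewrite ord1 mxE.
have /eqP := u0 i (mem_index_enum i).
by move/eqP; rewrite mulf_eq0 orbb => /eqP.
Qed.

Lemma mul_outer d (x y z : 'cV[R]_d) : x *m y^T *m z = dotv y z *: x.
Proof.
rewrite -mulmxA [y^T *m z]mx11_scalar -/(dotv y z).
by rewrite mul_mx_scalar.
Qed.

Lemma dotv_col m n (u u' : 'cV[R]_m) (v v' : 'cV[R]_n) :
  dotv (col_mx u v) (col_mx u' v') = dotv u u' + dotv v v'.
Proof. by rewrite /dotv tr_col_mx mul_row_col mxE. Qed.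

Definition posdef d (A : 'M[R]_d) : Prop :=
  A^T = A /\ forall y : 'cV[R]_d, y != 0 -> 0 < dotv y (A *m y).

Lemma posdef_form_ge0 d (A : 'M[R]_d) y : posdef A -> 0 <= dotv y (A *m y).
Proof.
move=> [_ Ap]; have [->|/Ap/ltW//] := eqVneq y 0.
by rewrite mulmx0 dotv0r.
Qed.

Lemma posdef_unit d (A : 'M[R]_d) : posdef A -> A \in unitmx.
Proof.
move=> [At Ap]; rewrite -row_free_unit -kermx_eq0; apply/rowV0P => v.
move=> /sub_kermxP vA; apply/eqP/negPn/negP => v0.
have /Ap : v^T != 0 by apply: contraNneq v0 => v0; rewrite -(trmxK v) v0 linear0.
by rewrite dotv_trmx dotvC At -At -trmx_mul vA trmx0 dotv0r ltxx.
Qed.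

Lemma posdef_inv d (A : 'M[R]_d) : posdef A -> posdef (invmx A).
Proof.
move=> pA; have uA := posdef_unit pA; have [At Ap] := pA.
split=> [|y y0]; first by rewrite trmx_inv At.
have z0 : invmx A *m y != 0.
  by apply: contraNneq y0 => z0; rewrite -(mulKVmx uA y) z0 mulmx0.
by have := Ap _ z0; rewrite mulKVmx // dotvC.
Qed.

Lemma posdef_CauchySchwarz d (A : 'M[R]_d) u v : posdef A ->
  `|dotv u (A *m v)| <= Num.sqrt (dotv u (A *m u)) * Num.sqrt (dotv v (A *m v)).
Proof.
move=> pA; have [At Ap] := pA.
have [->|v0] := eqVneq v 0.
  by rewrite mulmx0 !dotv0r normr0 mulr_ge0 ?sqrtr_ge0.
have Av := Ap _ v0; have Au := posdef_form_ge0 u pA.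
rewrite -sqrtrM // -sqrtr_sqr ler_sqrt ?mulr_ge0 ?(ltW Av) //.
have := posdef_form_ge0 (u - (dotv u (A *m v) / dotv v (A *m v)) *: v) pA.
rewrite mulmxBr dotvBl !dotvBr -!scalemxAr !(dotvZr,dotvZl).
have -> : dotv v (A *m u) = dotv u (A *m v) by rewrite dotv_trmx At dotvC.
set p := dotv u (A *m v); set q := dotv v (A *m v).
rewrite (_ : _ - _ = dotv u (A *m u) - p ^+ 2 / q); last first.
  by rewrite /q; field; rewrite gt_eqF.
by rewrite subr_ge0 ler_pdivrMr.
Qed.

Lemma invmx_rank1 d (A : 'M[R]_d) (x : 'cV[R]_d) : posdef A ->
  let u := invmx A *m x in
  invmx (A + x *m x^T) = invmx A - (1 + dotv x u)^-1 *: (u *m u^T).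
Proof.
move=> pA u; have uA := posdef_unit pA.
have [iAt _] := posdef_inv pA.
have uT : x^T *m invmx A = u^T by rewrite trmx_mul iAt.
have s0 : 1 + dotv x u != 0.
  by rewrite gt_eqF // ltr_pwDl // posdef_form_ge0 //; exact: posdef_inv.
set B := invmx A - _.
have AB : (A + x *m x^T) *m B = 1%:M.
  have Au : A *m u = x by rewrite mulKVmx.
  rewrite mulmxDl !mulmxBr mulmxV // -!scalemxAr (mulmxA A) Au -(mulmxA x) uT.
  rewrite (mulmxA (x *m x^T)) mul_outer -scalemxAl scalerA.
  set c := _^-1; set X := x *m u^T.
  rewrite -[X in _ + (X - _)]scale1r -addrA -scaleNr addrA -scalerBl.
  rewrite -addrA -scalerDl (_ : - c + (1 - c * dotv x u) = 0) ?scale0r ?addr0 // /c.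
  by field; rewrite s0.
have [U _] := mulmx1_unit AB.
by rewrite -[RHS](mulKmx U) AB mulmx1.
Qed.

Lemma det_1_outer d (u v : 'cV[R]_d) : \det (1%:M + u *m v^T) = 1 + dotv v u.
Proof.
pose M := block_mx (1%:M : 'M[R]_1) (- v^T) u (1%:M : 'M[R]_d).
have M1 : M = block_mx 1%:M 0 u 1%:M *m block_mx 1%:M (- v^T) 0 (1%:M + u *m v^T).
  rewrite mulmx_block !(mul1mx, mulmx1, mul0mx, mulmx0, addr0, add0r) mulmxN.
  by rewrite addrC addrK.
have M2 : M = block_mx (1%:M + v^T *m u) (- v^T) 0 1%:M *m block_mx 1%:M 0 u 1%:M.
  rewrite mulmx_block !(mul1mx, mulmx1, mul0mx, mulmx0, addr0, add0r) mulNmx.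
  by rewrite addrK.
have := congr1 determinant M1.
rewrite {1}M2 !det_mulmx !det_lblock !det_ublock !det1 !mul1r !mulr1 => <-.
by rewrite det_mx11 mxE mxE eqxx.
Qed.

Lemma det_rank1 d (A : 'M[R]_d) (x : 'cV[R]_d) : A \in unitmx ->
  \det (A + x *m x^T) = \det A * (1 + dotv x (invmx A *m x)).
Proof.
move=> uA; rewrite -det_1_outer -det_mulmx mulmxDr mulmx1 !mulmxA.
by rewrite mulmxV // mul1mx.
Qed.

Lemma posdef_diag_gt0 d (A : 'M[R]_d) i : posdef A -> 0 < A i i.
Proof.
move=> [_ Ap]; have /Ap : delta_mx i 0 != 0 :> 'cV[R]_d.
  by apply/negP => /eqP /matrixP/(_ i 0)/eqP; rewrite !mxE !eqxx oner_eq0.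
by rewrite -colE dotvE (bigD1 i) //= big1 => [|j ji];
  rewrite !mxE ?(negbTE ji) ?eqxx ?mul0r // addr0 mul1r.
Qed.

Lemma det_schur d (v : R) (w : 'cV[R]_d) (B : 'M[R]_d) : v != 0 ->
  \det (block_mx v%:M w^T w B) = v * \det (B - v^-1 *: (w *m w^T)).
Proof.
move=> v0.
have -> : block_mx v%:M w^T w B = block_mx v%:M 0 w 1%:M
   *m block_mx 1%:M (v^-1 *: w^T) 0 (B - v^-1 *: (w *m w^T)).
  rewrite mulmx_block !(mul1mx, mulmx1, mul0mx, mulmx0, addr0, add0r) mul_scalar_mx.
  by rewrite scalerA mulfV // scale1r -scalemxAr addrC subrK.
by rewrite det_mulmx det_lblock det_ublock !det1 det_scalar1 !(mulr1,mul1r).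
Qed.

Lemma posdef_schur d (v : R) (w : 'cV[R]_d) (B : 'M[R]_d) :
  posdef (block_mx v%:M w^T w B) -> 0 < v /\ posdef (B - v^-1 *: (w *m w^T)).
Proof.
move=> pA; have v0 : 0 < v.
  by have := posdef_diag_gt0 (lshift d 0) pA; rewrite block_mxEul mxE eqxx.
split=> //; have [At Ap] := pA.
have BT : B^T = B.
  by move: At; rewrite tr_block_mx => /eq_block_mx [].
split; first by rewrite linearB linearZ /= trmx_mul trmxK BT.
move=> y y0.
pose z := col_mx (- (v^-1 * dotv w y))%:M y.
have /Ap : z != 0.
  apply: contraNneq y0 => z0.
  by rewrite -(col_mxKd (- (v^-1 * dotv w y))%:M y) -/z z0 linear0.
rewrite /z mul_block_col -scalar_mxM mul_mx_scalar.
have -> : w^T *m y = (dotv w y)%:M by rewrite [LHS]mx11_scalar.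
rewrite -[(_ * _)%:M + _]raddfD /= mulrN mulrA mulfV ?gt_eqF // mul1r addNr raddf0.
rewrite dotv_col dotv0r add0r dotvDr dotvZr (dotvC y w) mulmxBl dotvBr.
by rewrite -scalemxAl mul_outer !dotvZr (dotvC y w) addrC mulNr mulrA.
Qed.

(* Induction on the Schur complement of the first diagonal entry, whose diagonal
   is dominated by that of the matrix. *)
Lemma hadamard d (A : 'M[R]_d) : posdef A -> 0 < \det A <= \prod_i A i i.
Proof.
elim: d A => [|d IH] A pA; first by rewrite det_mx00 big_ord0 ltr01 lexx.
pose v := A 0 0; pose w : 'cV[R]_d := dlsubmx (A : 'M[R]_(1 + d)).
pose B : 'M[R]_d := drsubmx (A : 'M[R]_(1 + d)).
have [At _] := pA.
have AE : (A : 'M[R]_(1 + d)) = block_mx v%:M w^T w B.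
  rewrite -[LHS](@submxK _ 1 d 1 d); congr block_mx.
    by rewrite [LHS]mx11_scalar !mxE /v; congr ((A _ _)%:M); exact: val_inj.
  by rewrite /w -{1}At -trmx_dlsub.
have [v0 pS] : 0 < v /\ posdef (B - v^-1 *: (w *m w^T)).
  by apply: posdef_schur; rewrite -AE.
have -> : \det A = v * \det (B - v^-1 *: (w *m w^T)).
  by rewrite -det_schur ?gt_eqF // -AE.
have /andP[S0 SE] := IH _ pS; rewrite mulr_gt0 //=.
rewrite big_ord_recl ler_pM2l //; apply: le_trans SE _.
apply: ler_prod => i _; rewrite ltW ?posdef_diag_gt0 //=.
rewrite /B !mxE big_ord1 !mxE -expr2.
rewrite (_ : rshift 1 i = lift ord0 i); last exact: val_inj.
by rewrite gerBl mulr_ge0 ?sqr_ge0 // invr_ge0 ltW.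
Qed.

Lemma det_le_trace d (A : 'M[R]_d) : posdef A -> \det A <= (\tr A / d%:R) ^+ d.
Proof.
move=> pA; have /andP[_ +] := hadamard pA; move/le_trans; apply.
have := @leif_AGM R 'I_d predT (fun i => A i i).
rewrite card_ord /= => H; have [|+ _] := H.
  by move=> i _; rewrite ltW ?posdef_diag_gt0.
rewrite /mxtrace; under eq_bigl do rewrite inE.
by under [X in X / _]eq_bigl do rewrite inE.
Qed.

Lemma posdef_inv_form_le d (A : 'M[R]_d) (r : R) x : 0 < r -> posdef A ->
  (forall y, r * dotv y y <= dotv y (A *m y)) ->
  r * dotv x (invmx A *m x) <= dotv x x.
Proof.
move=> r0 pA rA; have uA := posdef_unit pA; set y := invmx A *m x.
have xE : A *m y = x by rewrite mulKVmx.
have := rA y; rewrite xE dotvC => rxy.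
(* Expand 0 <= |x - r y|^2 and use r |y|^2 <= <x, y>. *)
have := dotv_ge0 (x - r *: y).
rewrite dotvBl !dotvBr !(dotvZl, dotvZr) (dotvC y x) => H.
have : r * (r * dotv y y) <= r * dotv x y by rewrite ler_pM2l.
lra.
Qed.

End PosDef.

(** * Elliptical potential *)

Section Potential.
Variables (R : realType) (d N : nat).
Variables (ridge : R) (x : nat -> 'cV[R]_d) (act : nat -> 'I_N) (b : 'I_N).
Hypothesis ridge0 : 0 < ridge.
Local Notation V := (Vmat ridge x act b).
Local Notation s2 t := (dotv (x t) (invmx (V t) *m x t)).

Lemma Vmat1 : V 1 = ridge%:M.
Proof. by rewrite /Vmat big_geq // addr0. Qed.

Lemma VmatS t : (0 < t)%N ->
  V t.+1 = if act t == b then V t + x t *m (x t)^T else V t.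
Proof.
move=> t0; rewrite /Vmat big_mkcond big_nat_recr //= -big_mkcond addrA.
by case: ifP => //; rewrite addr0.
Qed.

Lemma Vmat_form t y : dotv y (V t *m y) =
  ridge * dotv y y + \sum_(1 <= s < t | act s == b) dotv (x s) y ^+ 2.
Proof.
rewrite /Vmat mulmxDl mul_scalar_mx dotvDr dotvZr; congr (_ + _).
rewrite mulmx_suml; elim/big_rec2: _ => [|s u v _ <-]; first exact: dotv0r.
by rewrite dotvDr mul_outer dotvZr (dotvC y (x s)) expr2.
Qed.

Lemma Vmat_lb t y : ridge * dotv y y <= dotv y (V t *m y).
Proof. by rewrite Vmat_form lerDl sumr_ge0 // => s _; exact: sqr_ge0. Qed.

Lemma posdef_Vmat t : posdef (V t).
Proof.
split.
  rewrite /Vmat linearD /= tr_scalar_mx linear_sum /=; congr (_ + _).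
  by apply: eq_bigr => s _; rewrite trmx_mul trmxK.
move=> y y0; apply: lt_le_trans (Vmat_lb t y).
by rewrite mulr_gt0 // dotv_gt0.
Qed.

Lemma width_ge0 t u : 0 <= dotv u (invmx (V t) *m u).
Proof. exact/posdef_form_ge0/posdef_inv/posdef_Vmat. Qed.

Lemma det_Vmat_gt0 t : 0 < \det (V t).
Proof. by have /andP[] := hadamard (posdef_Vmat t). Qed.

Lemma ln_det_Vmat t : (0 < t)%N -> ln (\det (V t) / ridge ^+ d) =
  \sum_(1 <= s < t | act s == b) ln (1 + s2 s).
Proof.
elim: t => // -[_ _|t IH _].
  by rewrite Vmat1 det_scalar big_geq // divff ?ln1 // expf_neq0 ?gt_eqF.
rewrite big_mkcond big_nat_recr //= -big_mkcond /= -IH // VmatS //.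
case: ifP => [_|]; last by rewrite addr0.
rewrite det_rank1; last exact/posdef_unit/posdef_Vmat.
rewrite mulrAC lnM // posrE ?divr_gt0 ?det_Vmat_gt0 ?exprn_gt0 //.
by rewrite ltr_pwDl ?width_ge0.
Qed.

Lemma tr_Vmat_le t : (forall s, (1 <= s < t)%N -> dotv (x s) (x s) <= 1) ->
  \tr (V t) <= d%:R * ridge + t.-1%:R.
Proof.
move=> x1; rewrite /Vmat mxtraceD mxtrace_scalar (mulr_natl ridge d) lerD2l raddf_sum /=.
rewrite big_mkcond /=.
apply: (@le_trans _ _ (\sum_(1 <= s < t) 1)).
  rewrite big_nat [leRHS]big_nat; apply: ler_sum => s st; case: ifP => // _.
  by rewrite mxtrace_mulC trace_mx11; exact: x1.
by rewrite sumr_const_nat subn1.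
Qed.

Lemma ln_det_Vmat_le t : (forall s, (1 <= s < t)%N -> dotv (x s) (x s) <= 1) ->
  ln (\det (V t) / ridge ^+ d) <= d%:R * ln (1 + t.-1%:R / (d%:R * ridge)).
Proof.
move=> x1; have := det_Vmat_gt0 t; have := det_le_trace (posdef_Vmat t).
have := tr_Vmat_le x1.
have [d0|d0] := posnP d.
  have d0R : d%:R = 0 :> R by rewrite d0.
  have rd1 : ridge ^+ d = 1 by rewrite d0 expr0.
  have V1 : \det (V t) = 1 by move: (V t); rewrite d0 => M; exact: det_mx00.
  by move=> _ _ _; rewrite d0R rd1 V1 divr1 ln1 mul0r.
have d0' : 0 < d%:R :> R by rewrite ltr0n.
move=> trV detV detV0.
have u0 : 0 < 1 + t.-1%:R / (d%:R * ridge).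
  by rewrite ltr_pwDl // divr_ge0 // mulr_ge0 // ltW.
rewrite mulr_natl -lnXn // ler_ln ?posrE ?divr_gt0 ?exprn_gt0 //.
rewrite ler_pdivrMr ?exprn_gt0 // -exprMn; apply: le_trans detV _.
have tr0 : 0 <= \tr (V t).
  by apply: sumr_ge0 => i _; rewrite ltW ?posdef_diag_gt0 //; exact: posdef_Vmat.
rewrite lerXn2r ?nnegrE ?divr_ge0 // ?mulr_ge0 // ?(ltW u0) ?(ltW ridge0) //.
rewrite ler_pdivrMr //; apply: le_trans trV _.
rewrite le_eqVlt; apply/orP; left; apply/eqP; field.
by rewrite !gt_eqF.
Qed.

End Potential.

Lemma le_2ln1D (R : realType) (u : R) : 0 <= u <= 1 -> u <= 2 * ln (1 + u).
Proof.
move=> /andP[u0 u1]; have u1' : 0 < 1 + u by lra.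
have v0 : 0 < (1 + u)^-1 by rewrite invr_gt0.
have H : ln (1 + u)^-1 <= (1 + u)^-1 - 1.
  have -> : (1 + u)^-1 = 1 + ((1 + u)^-1 - 1) by lra.
  by rewrite [X in _ <= X]addrC addKr; apply: le_ln1Dx; lra.
rewrite lnV ?posrE // in H.
have E : u / (1 + u) = 1 - (1 + u)^-1 by field; lra.
have : u / (1 + u) <= ln (1 + u) by lra.
have : u / 2 <= u / (1 + u).
  by rewrite ler_pdivrMr // mulrAC ler_pdivlMr //; nra.
lra.
Qed.

Section SumWidths.
Variables (R : realType) (d N T : nat).
Variables (ridge : R) (x : nat -> 'cV[R]_d) (act : nat -> 'I_N).
Hypothesis ridge1 : 1 <= ridge.
Hypothesis x1 : forall t, (1 <= t <= T)%N -> dotv (x t) (x t) <= 1.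

Lemma width_le1 b t : (1 <= t <= T)%N ->
  dotv (x t) (invmx (Vmat ridge x act b t) *m x t) <= 1.
Proof.
move=> tT; have r0 := lt_le_trans ltr01 ridge1.
have := posdef_inv_form_le (x t) r0 (posdef_Vmat x act b r0 t) (Vmat_lb ridge x act b t).
move=> H; have W0 := width_ge0 x act b r0 t (x t).
apply: le_trans (x1 tT); apply: le_trans H.
by rewrite ler_peMl.
Qed.

Lemma sum_le_sqrt (f : nat -> R) :
  \sum_(1 <= t < T.+1) f t <= Num.sqrt (T%:R * \sum_(1 <= t < T.+1) f t ^+ 2).
Proof.
set S := \sum_(1 <= t < T.+1) f t; set Q := \sum_(1 <= t < T.+1) f t ^+ 2.
have key c : 2 * c * S <= Q + T%:R * c ^+ 2.
  have -> : T%:R * c ^+ 2 = \sum_(1 <= t < T.+1) c ^+ 2.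
    by rewrite sumr_const_nat subn1 mulr_natl.
  rewrite mulr_sumr -big_split /=; apply: ler_sum => t _.
  by have := sqr_ge0 (f t - c); nra.
have [T0|T0] := posnP T; first by rewrite /S T0 big_geq // sqrtr_ge0.
have T0' : 0 < T%:R :> R by rewrite ltr0n.
apply: le_trans (ler_norm _) _; rewrite -sqrtr_sqr ler_wsqrtr //.
have := key (S / T%:R).
have -> : T%:R * (S / T%:R) ^+ 2 = S ^+ 2 / T%:R by field; rewrite gt_eqF.
have -> : 2 * (S / T%:R) * S = 2 * (S ^+ 2 / T%:R) by field; rewrite gt_eqF.
move=> H; have : S ^+ 2 / T%:R <= Q by lra.
by rewrite ler_pdivrMr // mulrC.
Qed.

Lemma sum_widths_le :
  \sum_(1 <= t < T.+1) wnorm (Vmat ridge x act (act t) t) (x t) <=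
  Num.sqrt (2 * N%:R * d%:R * T%:R * ln (1 + T%:R / (d%:R * ridge))).
Proof.
have r0 := lt_le_trans ltr01 ridge1.
apply: le_trans (sum_le_sqrt _) _; apply: ler_wsqrtr.
set L := ln _.
rewrite (_ : 2 * _ * _ * _ * _ = T%:R * (N%:R * (2 * (d%:R * L)))); last by ring.
rewrite ler_wpM2l //.
apply: (@le_trans _ _ (\sum_(1 <= t < T.+1) \sum_(b < N | act t == b)
   2 * ln (1 + dotv (x t) (invmx (Vmat ridge x act b t) *m x t)))).
  rewrite big_nat [leRHS]big_nat; apply: ler_sum => t tT.
  rewrite (big_pred1 (act t)); last by move=> b; rewrite eq_sym.
  rewrite /wnorm sqr_sqrtr ?width_ge0 //.
  by apply: le_2ln1D; rewrite width_ge0 //= width_le1.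
rewrite (exchange_big_dep predT) //=.
apply: (@le_trans _ _ (\sum_(b < N) 2 * (d%:R * L))); last first.
  by rewrite sumr_const card_ord (mulr_natl _ N).
apply: ler_sum => b _; rewrite -mulr_sumr ler_pM2l // -ln_det_Vmat //.
apply: le_trans (ln_det_Vmat_le act b r0 (t := T.+1) _) _; last by [].
by move=> s; exact: x1.
Qed.
End SumWidths.

(** * Regret on the confidence event *)

Section FMax.
Variables (R : realType) (T : finType).

Lemma fmax_ge (A : {pred T}) (F : T -> R) i : i \in A -> F i <= fmax A F.
Proof. by move=> iA; rewrite /fmax; exact: le_bigmax_cond. Qed.

Lemma fmax_le (A : {pred T}) (F : T -> R) i c : i \in A ->
  (forall j, j \in A -> F j <= c) -> fmax A F <= c.
Proof.
move=> iA Fc; rewrite /fmax; apply: bigmax_le => //.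
by case: pickP => [j /Fc //|/(_ i)]; rewrite iA.
Qed.

End FMax.

Lemma greedy_card (R : realType) N ts Delta (prev : {set 'I_N}) (gamma : R) k
    Ccur best out :
  greedy_spec ts Delta prev gamma k Ccur best out -> (#|out| <= #|Ccur| + k)%N.
Proof.
elim: k Ccur best => [|k IH] Ccur best /=; first by move=> ->; rewrite addn0.
case=> [[_ ->]|[a0 [a0C _ _ /IH]]]; first by rewrite leq_addr.
by rewrite cardsU1 a0C add1n addSnnS.
Qed.

Section Regret.
Variables (R : realType) (d N K T H : nat).
Variables (theta : 'I_N -> 'cV[R]_d) (lam : 'I_N -> R).
Variables (alpha gamma sigma ridge delta : R).
Variables (x : nat -> 'cV[R]_d) (eta : nat -> 'I_N -> R).
Variables (act : nat -> 'I_N) (C : nat -> {set 'I_N}).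

Definition noise_sum (b : 'I_N) t : 'cV[R]_d :=
  \sum_(1 <= s < t | act s == b) eta s b *: x s.

Local Notation q := (qobs theta x eta act).
Local Notation V := (Vmat ridge x act).
Local Notation bt := (beta d N sigma ridge delta).

Hypothesis ridge1 : 1 <= ridge.
Hypothesis theta1 : forall b, dotv (theta b) (theta b) <= 1.
Hypothesis x1 : forall t, (1 <= t <= T)%N -> dotv (x t) (x t) <= 1.
Let ridge0 : 0 < ridge := lt_le_trans ltr01 ridge1.

Lemma bvecE b t : bvec x q act b t =
  noise_sum b t + (V b t *m theta b - ridge *: theta b).
Proof.
rewrite /Vmat mulmxDl mul_scalar_mx [X in _ + X]addrAC subrr add0r mulmx_suml.
rewrite /bvec /noise_sum -big_split /=; apply: eq_bigr => s /eqP sb.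
by rewrite /qobs sb mul_outer scalerDl addrC (dotvC (x s)).
Qed.

Lemma thetahat_err b t : thetahat ridge x q act b t - theta b =
  invmx (V b t) *m noise_sum b t - ridge *: (invmx (V b t) *m theta b).
Proof.
rewrite /thetahat bvecE mulmxDr mulmxBr mulKmx; last first.
  exact/posdef_unit/posdef_Vmat.
by rewrite -scalemxAr addrA addrAC addrK.
Qed.

Hypothesis sigma0 : 0 < sigma.
Hypothesis N_delta : 1 <= N%:R / delta.

Let rad t := d%:R * ln (1 + t%:R / (d%:R * ridge)) + 2 * ln (N%:R / delta).

Lemma log1D_le s t : (s <= t)%N ->
  0 <= ln (1 + s%:R / (d%:R * ridge)) <= ln (1 + t%:R / (d%:R * ridge)).
Proof.
move=> st; have dr0 : 0 <= d%:R * ridge by rewrite mulr_ge0 // ltW.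
have s0 : 0 <= s%:R / (d%:R * ridge) by rewrite divr_ge0.
have stD : s%:R / (d%:R * ridge) <= t%:R / (d%:R * ridge).
  by rewrite ler_wpM2r ?invr_ge0 // ler_nat.
rewrite ln_ge0 ?lerDl //= ler_ln ?posrE ?lerD2l //; rewrite ltr_pwDl //.
exact: le_trans stD.
Qed.

Lemma rad_ge0 t : 0 <= rad t.
Proof.
have /andP[L0 _] := log1D_le (leqnn t).
by rewrite addr_ge0 // mulr_ge0 // ln_ge0.
Qed.

Lemma beta_ge0 t : 0 <= bt t.
Proof. by rewrite addr_ge0 ?sqrtr_ge0 // mulr_ge0 ?sqrtr_ge0 // ltW. Qed.

Lemma beta_le s t : (s <= t)%N -> bt s <= bt t.
Proof.
move=> st; rewrite lerD2r ler_pM2l // ler_sqrt ?rad_ge0 // lerD2r.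
by rewrite ler_wpM2l //; have /andP[] := log1D_le st.
Qed.

Hypothesis conf : forall b t, (1 <= t <= T)%N ->
  dotv (noise_sum b t) (invmx (V b t) *m noise_sum b t) <= sigma ^+ 2 * rad t.

Lemma estimate_err b t : (1 <= t <= T)%N ->
  `|dotv (thetahat ridge x q act b t) (x t) - dotv (theta b) (x t)|
    <= bt t * wnorm (V b t) (x t).
Proof.
move=> tT; rewrite -dotvBl thetahat_err dotvBl dotvZl.
have pV := posdef_Vmat x act b ridge0 t; have pI := posdef_inv pV.
set s := wnorm _ _; rewrite [leRHS]mulrDl.
apply: le_trans (ler_normB _ _) _; apply: lerD.
  rewrite dotvC; apply: le_trans (posdef_CauchySchwarz _ _ pI) _.
  rewrite mulrC ler_wpM2r ?sqrtr_ge0 //.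
  rewrite -[X in X * _](gtr0_norm sigma0) -sqrtr_sqr -sqrtrM ?sqr_ge0 //.
  by apply: ler_wsqrtr; exact: conf.
rewrite normrM (gtr0_norm ridge0) dotvC.
have := posdef_inv_form_le (theta b) ridge0 pV (Vmat_lb ridge x act b t).
move=> /le_trans/(_ (theta1 b)) th1.
have th2 : Num.sqrt (dotv (theta b) (invmx (V b t) *m theta b)) <= (Num.sqrt ridge)^-1.
  rewrite -sqrtrV ?(ltW ridge0) //; apply: ler_wsqrtr.
  by rewrite -[leRHS]mul1r ler_pdivlMr // mulrC.
have := posdef_CauchySchwarz (x t) (theta b) pI.
rewrite -/(wnorm _ _) -/s => CS.
have s0 : 0 <= s by exact: sqrtr_ge0.
have sr0 : 0 < Num.sqrt ridge by rewrite sqrtr_gt0.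
have : ridge * `|dotv (x t) (invmx (V b t) *m theta b)|
    <= ridge * (s * (Num.sqrt ridge)^-1).
  by rewrite ler_pM2l //; apply: le_trans CS _; rewrite ler_wpM2l.
move=> /le_trans; apply.
rewrite -{1}(sqr_sqrtr (ltW ridge0)) le_eqVlt; apply/orP; left; apply/eqP; field.
by rewrite gt_eqF.
Qed.

Hypothesis alpha0 : 0 < alpha.
Hypothesis lam0 : forall b, 0 < lam b.
Hypothesis greedy_act : forall t, (1 <= t <= T)%N -> forall b,
  score sigma ridge delta alpha lam H x q act C t b
  <= score sigma ridge delta alpha lam H x q act C t (act t).

Lemma round_regret C0 t : (1 <= t <= T)%N ->
  fmax predT (fun b => mu theta lam alpha (x t) b C0)
   - mu theta lam alpha (x t) (act t) (C (epoch H t))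
  <= 2 * bt T * wnorm (V (act t) t) (x t) + alpha * fmax predT lam.
Proof.
move=> tT; rewrite lerBlDr; apply: (@fmax_le _ _ _ _ (act t)) => // b _.
have := estimate_err b tT; rewrite ler_distl => /andP[Eb _].
have := estimate_err (act t) tT; rewrite ler_distl => /andP[_ Ea].
have := greedy_act tT b; rewrite /score => G.
have lb : lam b <= fmax predT lam by exact: fmax_ge.
have := lam0 b.
have w0 : 0 <= wnorm (V (act t) t) (x t) by exact: sqrtr_ge0.
have : bt t * wnorm (V (act t) t) (x t) <= bt T * wnorm (V (act t) t) (x t).
  by rewrite ler_wpM2r // beta_le //; case/andP: tT.
have c0 (B : bool) : 0 <= alpha * lam b * B%:R <= alpha * fmax predT lam.
  have a0 := ltW alpha0; have l0 := ltW (lam0 b).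
  case: B; rewrite ?mulr1 ?mulr0; first by rewrite mulr_ge0 // ler_pM2l.
  by rewrite lexx mulr_ge0 // (le_trans l0).
have /andP[_ c1] := c0 (b \notin C (epoch H t)).
have /andP[c2 _] := c0 (b \notin C0).
rewrite /mu; lra.
Qed.

Hypothesis KN : (1 <= K <= N)%N.
Hypothesis gamma0 : 0 < gamma.
Hypothesis cacheK : forall l, (2 <= l <= nepochs T H)%N -> (#|C l| <= K)%N.

Lemma regret_le : regret theta lam alpha gamma K T H x act C
  <= 2 * bt T * Num.sqrt (2 * N%:R * d%:R * T%:R * ln (1 + T%:R / (d%:R * ridge)))
     + alpha * fmax predT lam * T%:R + (nepochs T H)%:R * K%:R * gamma.
Proof.
have [A AK] : exists A : {set 'I_N}, #|A| == K.
  have : (0 < #|[set A : {set 'I_N} | #|A| == K]%SET|)%N.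
    by rewrite card_draws card_ord bin_gt0; case/andP: KN.
  by case/card_gt0P => A; rewrite inE; exists A.
rewrite /regret lerBlDr; apply: (@fmax_le _ _ _ _ A) => // C0 _.
rewrite -lerBlDr opprB addrA -addrAC.
apply: (@le_trans _ _ (2 * bt T * \sum_(1 <= t < T.+1) wnorm (V (act t) t) (x t)
   + alpha * fmax predT lam * T%:R + (nepochs T H)%:R * K%:R * gamma)).
  apply: lerD.
    rewrite -sumrB [in leRHS]mulr_sumr.
    have -> : alpha * fmax predT lam * T%:R = \sum_(1 <= t < T.+1) alpha * fmax predT lam.
      by rewrite sumr_const_nat subn1 mulr_natr.
    rewrite -big_split /= big_nat [leRHS]big_nat; apply: ler_sum => t tT.
    exact: round_regret.
  apply: (@le_trans _ _ (\sum_(2 <= l < (nepochs T H).+1) K%:R * gamma)).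
    rewrite big_nat [leRHS]big_nat; apply: ler_sum => l lT.
    rewrite mulrC ler_pM2r // ler_nat.
    apply: leq_trans (cacheK lT); apply: subset_leq_card; exact: subsetDl.
  rewrite sumr_const_nat -mulrA (mulr_natl _ (nepochs T H)); apply: ler_wpMn2l.
    by rewrite mulr_ge0 // ltW.
  by rewrite subSS leq_subr.
rewrite !lerD2r ler_wpM2l ?mulr_ge0 ?beta_ge0 //.
exact: sum_widths_le.
Qed.

End Regret.

(** * Conditional inequalities and Gaussian mixtures *)

Section Conditional.
Context (R : realType) (dO : measure_display) (Omega : measurableType dO).
Variables (P : probability Omega R) (GG : set (set Omega)).
Hypothesis GGm : <<s GG >> `<=` @measurable _ Omega.
Local Notation G := (g_sigma_algebraType GG).

Lemma measurable_fun_sub (d' : measure_display) (T' : measurableType d') (f : G -> T') :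
  measurable_fun setT f -> measurable_fun setT (f : Omega -> T').
Proof.
move=> mf _ B mB; rewrite setTI; apply: GGm.
by have := mf measurableT B mB; rewrite setTI.
Qed.

Import HBNNSimple.

(* The hypothesis on Y says that its conditional expectation given the
   sigma-algebra generated by GG is at most 1. *)
Lemma integral_cond_le (Y : Omega -> R) : measurable_fun setT Y ->
  (forall w, 0 <= Y w) ->
  (forall B, <<s GG >> B -> (\int[P]_(w in B) (Y w)%:E <= P B)%E) ->
  forall f : G -> R, measurable_fun [set: G] f -> (forall w, 0 <= f w) ->
  (\int[P]_w (f w * Y w)%:E <= \int[P]_w (f w)%:E)%E.
Proof.
move=> mY Y0 YP f mf f0.
have mEf : measurable_fun [set: G] (EFin \o f) by exact/measurable_EFinP.
pose g := nnsfun_approx measurableT mEf.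
have mg n : measurable_fun setT (g n : Omega -> R).
  by apply: measurable_fun_sub; exact: measurable_funP.
have mfO : measurable_fun setT (f : Omega -> R) by exact: measurable_fun_sub.
have g_nd w : {homo (fun n => g n w) : n k / (n <= k)%N >-> n <= k}.
  by move=> n k nk; exact/lefP/nd_nnsfun_approx.
have g_cvg w : (g n w)%:E @[n --> \oo] --> (f w)%:E.
  by apply: (cvg_nnsfun_approx measurableT mEf) => // t _; rewrite lee_fin.
have gY_cvg w : (g n w * Y w)%:E @[n --> \oo] --> (f w * Y w)%:E.
  by under eq_fun do rewrite EFinM; rewrite EFinM; apply: cvgeZr.
have mA n r : <<s GG >> (g n @^-1` [set r]).
  have := measurable_funP (g n) measurableT [set r] (measurable_set1 r).
  by rewrite setTI.
have intgZ n (Z : Omega -> R) : measurable_fun setT Z -> (forall w, 0 <= Z w) ->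
    (\int[P]_w (g n w * Z w)%:E = \sum_(i < #|` fset_set (range (g n))|)
       ((fset_set (range (g n)))`_i)%:E
       * \int[P]_(w in g n @^-1` [set (fset_set (range (g n)))`_i]) (Z w)%:E)%E.
  move=> mZ Z0; set s := fset_set _.
  have s0 (i : 'I_#|` s|) : 0 <= s`_i.
    have : s`_i \in s by exact: mem_nth.
    by rewrite in_fset_set // => /set_mem[w _ <-].
  have m1Z (i : 'I_#|` s|) : measurable_fun setT
      (fun w : Omega => (\1_(g n @^-1` [set s`_i]) w * Z w)).
    by apply: measurable_funM => //; apply: measurable_indic; exact: GGm.
  transitivity (\int[P]_w (\sum_(i < #|` s|)
      (s`_i)%:E * (\1_(g n @^-1` [set s`_i]) w * Z w)%:E))%E.
    apply: eq_integral => w _; rewrite fimfunEord mulr_suml -sumEFin.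
    by apply: eq_bigr => i _; rewrite -EFinM mulrA.
  rewrite ge0_integral_sum //.
  - apply: eq_bigr => i _; rewrite ge0_integralZl_EFin //.
    + congr (_ * _)%E; rewrite [RHS]integral_mkcond epatch_indic.
      by apply: eq_integral => w _ /=; rewrite -EFinM mulrC.
    + by move=> w _; rewrite lee_fin mulr_ge0 // indicE.
    + exact/measurable_EFinP.
  - by move=> i; apply/measurable_EFinP; apply: measurable_funM.
  - by move=> i w _; rewrite -EFinM lee_fin !mulr_ge0 // indicE.
have step n : (\int[P]_w (g n w * Y w)%:E <= \int[P]_w (g n w)%:E)%E.
  have -> : (\int[P]_w (g n w)%:E = \int[P]_w (g n w * cst 1 w)%:E)%E.
    by apply: eq_integral => w _; rewrite mulr1.
  rewrite !intgZ //; apply: lee_sum => i _; apply: lee_wpmul2l.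
    rewrite lee_fin; set s := fset_set _.
    have : s`_i \in s by exact: mem_nth.
    by rewrite in_fset_set // => /set_mem[w _ <-].
  apply: le_trans (YP _ (mA n _)) _.
  by rewrite (integral_cst P _ 1%:E) ?mul1e //; exact: GGm.
have gf n : (\int[P]_w (g n w)%:E <= \int[P]_w (f w)%:E)%E.
  apply: ge0_le_integral => //; try exact/measurable_EFinP.
    by move=> w _; rewrite lee_fin.
  move=> w _; apply: cvge_to_ge (g_cvg w) _.
  by exists n => // k /= nk; rewrite lee_fin; exact: g_nd.
have cvgI : (\int[P]_w (g n w * Y w)%:E)%E @[n --> \oo] -->
    (\int[P]_w (f w * Y w)%:E)%E.
  have -> : (\int[P]_w (f w * Y w)%:E = \int[P]_w (limn (fun n => (g n w * Y w)%:E)))%E.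
    by apply: eq_integral => w _; apply/esym/cvg_lim.
  apply: cvg_monotone_convergence => //.
  - by move=> n; apply/measurable_EFinP; exact: measurable_funM.
  - by move=> n w _; rewrite lee_fin mulr_ge0.
  - by move=> w _ n k nk; rewrite lee_fin ler_wpM2r // g_nd.
rewrite -(cvg_lim _ cvgI) //; apply: lime_le; first by apply/cvg_ex; eexists; exact: cvgI.
by apply: nearW => n; exact: le_trans (step n) (gf n).
Qed.
End Conditional.

Lemma measurable_invr (R : realType) : measurable_fun [set: R] (@GRing.inv R).
Proof.
have -> : @GRing.inv R = (fun y => y * (y ^+ 2) `^ (-1)).
  apply/funext => y; rewrite powR_inv1 ?sqr_ge0 //.
  have [->|y0] := eqVneq y 0; first by rewrite invr0 mul0r.
  by field.
apply: measurable_funM => //.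
by apply: (measurableT_comp (measurable_powR _)); exact: measurable_funX.
Qed.

Lemma measurable_sqrtr (R : realType) : measurable_fun [set: R] (@Num.sqrt R).
Proof. by apply: continuous_measurable_fun; exact: sqrt_continuous. Qed.

Section GaussMixture.
Variable R : realType.
Implicit Types m v e z : R.

Definition gauss_dens m v z :=
  (Num.sqrt (2 * (v * pi)))^-1 * expR (- (z - m) ^+ 2 / (2 * v)).

(* The integral of exp (z e - z^2 / 2) over z of law N(m, v), v being the
   variance; see integral_gauss_tilt. *)
Definition gauss_gain m v e :=
  (Num.sqrt (1 + v))^-1 * expR ((v * e ^+ 2 + 2 * e * m - m ^+ 2) / (2 * (1 + v))).

Lemma gauss_dens_ge0 m v z : 0 <= gauss_dens m v z.
Proof. by rewrite mulr_ge0 ?expR_ge0 // invr_ge0 sqrtr_ge0. Qed.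

Lemma gauss_gain_ge0 m v e : 0 <= gauss_gain m v e.
Proof. by rewrite mulr_ge0 ?expR_ge0 // invr_ge0 sqrtr_ge0. Qed.

Lemma gauss_densE m v : 0 < v -> gauss_dens m v = normal_pdf m (Num.sqrt v).
Proof.
move=> v0; rewrite normal_pdfE ?gt_eqF ?sqrtr_gt0 //; apply/funext => z.
rewrite /normal_peak /normal_fun sqr_sqrtr ?(ltW v0) //.
by rewrite -(mulr_natl (v * pi)) -(mulr_natl v).
Qed.

Lemma integral_gauss_dens m v : 0 < v ->
  (\int[lebesgue_measure]_z (gauss_dens m v z)%:E = 1)%E.
Proof. by move=> v0; rewrite gauss_densE //; exact: integral_normal_pdf. Qed.

Lemma gauss_dens_tilt m v e z : 0 < v ->
  gauss_dens m v z * expR (z * e - z ^+ 2 / 2) =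
  gauss_gain m v e * gauss_dens ((m + v * e) / (1 + v)) (v / (1 + v)) z.
Proof.
move=> v0; rewrite /gauss_dens /gauss_gain mulrACA -mulrA -!expRD; congr (_ * expR _).
  rewrite -invfM -sqrtrM ?addr_ge0 ?(ltW v0) //; congr (Num.sqrt _)^-1.
  by field; lra.
by field; lra.
Qed.

Lemma integral_gauss_tilt m v e : 0 < v ->
  (\int[lebesgue_measure]_z (gauss_dens m v z * expR (z * e - z ^+ 2 / 2))%:E
   = (gauss_gain m v e)%:E)%E.
Proof.
move=> v0; have v0' : 0 < v / (1 + v) by rewrite divr_gt0 // ltr_pwDl // ltW.
under eq_integral do rewrite gauss_dens_tilt // EFinM.
rewrite ge0_integralZl_EFin //.
- by rewrite integral_gauss_dens // mule1.
- by move=> z _; rewrite lee_fin gauss_dens_ge0.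
- by apply/measurable_EFinP; rewrite gauss_densE //; exact: measurable_normal_pdf.
- exact: gauss_gain_ge0.
Qed.

Lemma measurable_gauss_dens d (T : measurableType d) (m v z : T -> R) :
  measurable_fun setT m -> measurable_fun setT v -> measurable_fun setT z ->
  measurable_fun setT (fun t => gauss_dens (m t) (v t) (z t)).
Proof.
move=> mm mv mz; apply: measurable_funM.
  apply: (measurableT_comp (@measurable_invr R)).
  apply: (measurableT_comp (@measurable_sqrtr R)).
  by do 2 apply: measurable_funM => //.
apply: measurableT_comp => //; apply: measurable_funM.
  by apply: measurable_funN; apply: measurable_funX; exact: measurable_funB.
by apply: (measurableT_comp (@measurable_invr R)); exact: measurable_funM.
Qed.

Lemma measurable_gauss_gain d (T : measurableType d) (m v e : T -> R) :
  measurable_fun setT m -> measurable_fun setT v -> measurable_fun setT e ->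
  measurable_fun setT (fun t => gauss_gain (m t) (v t) (e t)).
Proof.
move=> mm mv me.
have m1v : measurable_fun setT (fun t => 1 + v t) by exact: measurable_funD.
apply: measurable_funM.
  apply: (measurableT_comp (@measurable_invr R)).
  exact: (measurableT_comp (@measurable_sqrtr R)).
apply: measurableT_comp => //; apply: measurable_funM.
  apply: measurable_funB; last exact: measurable_funX.
  by apply: measurable_funD; do ?[apply: measurable_funM => //]; exact: measurable_funX.
apply: (measurableT_comp (@measurable_invr R)).
exact: measurable_funM.
Qed.

Context (dO : measure_display) (Omega : measurableType dO).
Variables (P : probability Omega R) (GG : set (set Omega)).
Hypothesis GGm : <<s GG >> `<=` @measurable _ Omega.
Local Notation G := (g_sigma_algebraType GG).

Lemma gauss_gain_cond_le (eta : Omega -> R) (f m v : G -> R) :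
  measurable_fun setT eta ->
  (forall s B, <<s GG >> B ->
     (\int[P]_(w in B) (expR (s * eta w))%:E <= (expR (s ^+ 2 / 2))%:E * P B)%E) ->
  measurable_fun [set: G] f -> measurable_fun [set: G] m ->
  measurable_fun [set: G] v ->
  (forall w, 0 <= f w) -> (forall w, 0 < v w) ->
  (\int[P]_w (f w * gauss_gain (m w) (v w) (eta w))%:E <= \int[P]_w (f w)%:E)%E.
Proof.
move=> meta subG mf mm mv f0 v0.
have mfO := measurable_fun_sub GGm mf.
have mmO := measurable_fun_sub GGm mm.
have mvO := measurable_fun_sub GGm mv.
pose tilt e z := expR (z * e - z ^+ 2 / 2).
have mfst (g : Omega -> R) : measurable_fun setT g ->
    measurable_fun [set: Omega * measurableTypeR R] (g \o fst).
  by move=> mg; exact: measurableT_comp.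
have mdens : measurable_fun [set: Omega * measurableTypeR R]
    (fun p => f p.1 * gauss_dens (m p.1) (v p.1) p.2).
  apply: measurable_funM; first exact: mfst.
  by apply: measurable_gauss_dens; [exact: mfst|exact: mfst|exact: measurable_snd].
have mtilt : measurable_fun [set: Omega * measurableTypeR R]
    (fun p => tilt (eta p.1) p.2).
  apply: measurableT_comp => //; apply: measurable_funB.
    by apply: measurable_funM => //; exact: mfst.
  by apply: measurable_funM => //; exact: measurable_funX.
have mdens1 a c : measurable_fun setT (gauss_dens a c).
  exact: (measurable_gauss_dens (measurable_cst a) (measurable_cst c)
    (@measurable_id _ _ setT)).
have mtilt1 e : measurable_fun setT (tilt e).
  by apply: measurableT_comp => //; apply: measurable_funB; apply: measurable_funM.
have E1 : (\int[P]_w (f w * gauss_gain (m w) (v w) (eta w))%:E =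
   \int[P]_w \int[lebesgue_measure]_z
     (f w * gauss_dens (m w) (v w) z * tilt (eta w) z)%:E)%E.
  apply: eq_integral => w _.
  under eq_integral do rewrite -mulrA EFinM.
  rewrite ge0_integralZl_EFin //.
  - by rewrite integral_gauss_tilt // EFinM.
  - by move=> z _; rewrite lee_fin mulr_ge0 ?gauss_dens_ge0 ?expR_ge0.
  - by apply/measurable_EFinP; apply: measurable_funM; [exact: mdens1|exact: mtilt1].
have E2 : (\int[P]_w (f w)%:E =
   \int[P]_w \int[lebesgue_measure]_z (f w * gauss_dens (m w) (v w) z)%:E)%E.
  apply: eq_integral => w _.
  under eq_integral do rewrite EFinM.
  rewrite ge0_integralZl_EFin //.
  - by rewrite integral_gauss_dens // mule1.
  - by move=> z _; rewrite lee_fin ?gauss_dens_ge0.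
  - by apply/measurable_EFinP; exact: mdens1.
have mF1 : measurable_fun [set: Omega * measurableTypeR R]
    (fun p => (f p.1 * gauss_dens (m p.1) (v p.1) p.2 * tilt (eta p.1) p.2)%:E).
  by apply/measurable_EFinP; exact: measurable_funM.
have mF2 : measurable_fun [set: Omega * measurableTypeR R]
    (fun p => (f p.1 * gauss_dens (m p.1) (v p.1) p.2)%:E).
  exact/measurable_EFinP.
rewrite E1 E2.
rewrite (fubini_tonelli (m1 := P) (m2 := lebesgue_measure) _ mF1); last first.
  by move=> p; rewrite lee_fin !mulr_ge0 ?gauss_dens_ge0 ?expR_ge0.
rewrite (fubini_tonelli (m1 := P) (m2 := lebesgue_measure) _ mF2); last first.
  by move=> p; rewrite lee_fin !mulr_ge0 ?gauss_dens_ge0 ?expR_ge0.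
apply: ge0_le_integral => //.
- move=> z _; apply: integral_ge0 => w _; rewrite lee_fin.
  by rewrite !mulr_ge0 ?gauss_dens_ge0 ?expR_ge0.
- apply: (measurable_fun_fubini_tonelli_G (m1 := P)) mF1 _.
  by move=> p; rewrite lee_fin !mulr_ge0 ?gauss_dens_ge0 ?expR_ge0.
- apply: (measurable_fun_fubini_tonelli_G (m1 := P)) mF2 _.
  by move=> p; rewrite lee_fin !mulr_ge0 ?gauss_dens_ge0 ?expR_ge0.
move=> z _ /=.
apply: (integral_cond_le GGm (Y := fun w => tilt (eta w) z)).
- apply: measurableT_comp => //; apply: measurable_funB => //.
  exact: measurable_funM.
- by move=> w; exact: expR_ge0.
- move=> B GB; have mB := GGm GB.
  have -> : (\int[P]_(w in B) (tilt (eta w) z)%:E =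
      (expR (- (z ^+ 2 / 2)))%:E * \int[P]_(w in B) (expR (z * eta w))%:E)%E.
    rewrite -ge0_integralZl_EFin ?expR_ge0 //.
    + by apply: eq_integral => w _; rewrite -EFinM -expRD addrC.
    + apply/measurable_EFinP; apply: measurableT_comp => //.
      by apply: measurable_funM => //; exact: measurable_funTS.
  apply: le_trans (lee_wpmul2l _ (subG z B GB)) _; first by rewrite lee_fin expR_ge0.
  by rewrite muleA -EFinM -expRD addNr expR0 mul1e.
- apply: measurable_funM => //.
  exact: (measurable_gauss_dens mm mv (measurable_cst z)).
- by move=> w; rewrite mulr_ge0 ?gauss_dens_ge0.
Qed.
End GaussMixture.

(** * Ville's inequality *)

Section Ville.
Context (R : realType) (dO : measure_display) (Omega : measurableType dO).
Variables (P : probability Omega R) (W : nat -> Omega -> R) (c : R) (n : nat).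
Hypothesis c0 : 0 < c.
Hypothesis mW : forall t, (t <= n)%N -> measurable_fun setT (W t).
Hypothesis W0 : forall t w, 0 <= W t w.

Definition alive t := [set w | forall s, (s <= t)%N -> W s w < c].

Lemma aliveS t : alive t.+1 = alive t `&` [set w | W t.+1 w < c].
Proof.
apply/seteqP; split => w /=.
  by move=> al; split=> [s st|]; apply: al => //; exact: leqW.
by case=> al wt s; rewrite leq_eqVlt => /predU1P[->//|]; exact: al.
Qed.

Lemma alive0 : alive 0 = setT `&` [set w | W 0 w < c].
Proof.
rewrite setTI; apply/seteqP; split => w /=; first exact.
by move=> wc s; rewrite leqn0 => /eqP ->.
Qed.

Lemma measurable_alive t : (t <= n)%N -> measurable (alive t).
Proof.
have mlt s : (s <= n)%N -> measurable [set w | W s w < c].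
  move=> /mW mWs; have := measurable_fun_ltr mWs (measurable_cst c).
  by move=> /(_ measurableT [set true]); rewrite setTI; apply.
elim: t => [|t IH] tn; first by rewrite alive0 setTI; exact: mlt.
by rewrite aliveS; apply: measurableI; [apply: IH; exact: ltnW|exact: mlt].
Qed.

Lemma markov_split t (D : set Omega) : (t <= n)%N -> measurable D ->
  let D' := D `&` [set w | W t w < c] in
  (c%:E * P (D `\` D') + \int[P]_(w in D') (W t w)%:E
    <= \int[P]_(w in D) (W t w)%:E)%E.
Proof.
move=> tn mD; rewrite /=; set D1 := _ `&` _; have mWt := mW tn.
have mD1 : measurable D1.
  have := measurable_fun_ltr mWt (measurable_cst c).
  move=> /(_ measurableT [set true]); rewrite setTI => mlt.
  by apply: measurableI => //; exact: mlt.
have mDD : measurable (D `\` D1) by exact: measurableD.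
have DE : D = (D `\` D1) `|` D1 by rewrite setUC setDUK // => w [].
rewrite [in leRHS]DE ge0_integral_setU //; last first.
- by apply/disj_setPS => w [[_ ?] ?].
- by move=> w _; rewrite lee_fin.
- by apply/measurable_EFinP; exact: measurable_funTS.
apply: leeD => //; rewrite -(integral_cst P mDD); apply: ge0_le_integral => //.
- by move=> w _; rewrite lee_fin ltW.
- by apply/measurable_EFinP; exact: measurable_funTS.
- move=> w [Dw nD1] /=; rewrite lee_fin leNgt; apply/negP => wc.
  by apply: nD1; split.
Qed.

(* Doob's stopping argument: the mass of W stopped at its first passage above
   c never exceeds the integral of W 0. *)
Lemma ville_maximal :
  (forall t, (t < n)%N -> (\int[P]_(w in alive t) (W t.+1 w)%:E
      <= \int[P]_(w in alive t) (W t w)%:E)%E) ->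
  (c%:E * P (~` alive n) <= \int[P]_w (W 0 w)%:E)%E.
Proof.
move=> superW.
suff H t : (t <= n)%N -> (c%:E * P (~` alive t) +
    \int[P]_(w in alive t) (W t w)%:E <= \int[P]_w (W 0 w)%:E)%E.
  apply: le_trans (H n (leqnn n)); rewrite leeDl // integral_ge0 // => w _.
  by rewrite lee_fin.
elim: t => [|t IH] tn.
  have := markov_split tn measurableT; rewrite /= -alive0.
  by rewrite setTD.
have mA := measurable_alive (ltnW tn); have mA' := measurable_alive tn.
apply: le_trans (IH (ltnW tn)).
have -> : ~` alive t.+1 = ~` alive t `|` (alive t `\` alive t.+1).
  apply/seteqP; split => w /=.
    by move=> nA; have [Aw|nAw] := pselect (alive t w); [right|left].
  by case=> [nA A|[]//]; apply: nA; move: A; rewrite aliveS => -[].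
rewrite measureU //; [|exact: measurableC|exact: measurableD|]; last first.
  by apply/seteqP; split=> // w [? []].
rewrite ge0_muleDr ?measure_ge0 // -addeA leeD2l //.
apply: le_trans (superW t tn).
by have := markov_split tn mA; rewrite /= -aliveS.
Qed.

End Ville.

(** * Concentration of the noise sums *)

Section SelfNormalized.
Variables (R : realType) (d N : nat) (ridge sigma : R).
Variables (x : nat -> 'cV[R]_d) (eta : nat -> 'I_N -> R).
Variables (act : nat -> 'I_N) (b : 'I_N).
Hypothesis ridge0 : 0 < ridge.
Hypothesis sigma0 : 0 < sigma.
Local Notation V := (Vmat ridge x act b).
Local Notation S := (noise_sum x eta act b).

Lemma noise_sumS t : (0 < t)%N ->
  S t.+1 = if act t == b then S t + eta t b *: x t else S t.
Proof.
move=> t0; rewrite /noise_sum big_mkcond big_nat_recr //= -big_mkcond.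
by case: ifP => //; rewrite addr0.
Qed.

(* The method-of-mixtures process, i.e. the integral of the exponential
   supermartingales exp(<u, S> / sigma - u' (V - ridge I) u / 2) against the
   Gaussian law of u with covariance I / ridge. *)
Definition mixture t : R :=
  expR (dotv (S t) (invmx (V t) *m S t) / (2 * sigma ^+ 2))
  / Num.sqrt (\det (V t) / ridge ^+ d).

Lemma mixture_ge0 t : 0 <= mixture t.
Proof. by rewrite divr_ge0 ?expR_ge0 ?sqrtr_ge0. Qed.

Lemma mixture1 : mixture 1 = 1.
Proof.
rewrite /mixture /noise_sum big_geq // mulmx0 dotv0r mul0r expR0 Vmat1 det_scalar.
by rewrite divff ?sqrtr1 ?divr1 // expf_neq0 // gt_eqF.
Qed.

Lemma mixtureS t : (0 < t)%N ->
  mixture t.+1 = if act t == b then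
    mixture t * gauss_gain (dotv (x t) (invmx (V t) *m S t) / sigma)
      (dotv (x t) (invmx (V t) *m x t)) (eta t b / sigma)
  else mixture t.
Proof.
move=> t0; rewrite /mixture VmatS // noise_sumS //; case: ifP => // _.
have pV := posdef_Vmat x act b ridge0 t; have pI := posdef_inv pV.
have [It _] := pI.
rewrite invmx_rank1 // det_rank1 ?posdef_unit //.
set u := invmx (V t) *m x t; set Q := dotv (S t) _.
have v0 : 0 <= dotv (x t) u by exact: posdef_form_ge0.
have uS : dotv u (S t) = dotv (x t) (invmx (V t) *m S t).
  by rewrite [RHS]dotv_trmx It.
set p := dotv (x t) (invmx (V t) *m S t) in uS *; set v := dotv (x t) u in v0 *.
have D0 : 0 < \det (V t) / ridge ^+ d.
  by rewrite divr_gt0 ?exprn_gt0 ?det_Vmat_gt0.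
have v1 : 1 + v != 0 by rewrite gt_eqF // ltr_pwDl.
have s1 : sigma != 0 by rewrite gt_eqF.
set e := eta t b.
have -> : \det (V t) * (1 + v) / ridge ^+ d = \det (V t) / ridge ^+ d * (1 + v).
  by rewrite mulrAC.
have -> : dotv (S t + e *: x t) ((invmx (V t) - (1 + v)^-1 *: (u *m u^T))
    *m (S t + e *: x t)) = Q + (2 * e * p + e ^+ 2 * v - p ^+ 2) / (1 + v).
  rewrite mulmxBl -scalemxAl mul_outer dotvBr !dotvZr.
  rewrite (dotvC (S t + _) u) !mulmxDr -!scalemxAr !dotvDl !dotvDr !dotvZl !dotvZr.
  rewrite uS -/u (dotvC (S t) u) uS -/p (dotvC u (x t)) -/v -/Q.
  by field.
rewrite sqrtrM ?(ltW D0) // (invfM (Num.sqrt _)).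
have -> : (Q + (2 * e * p + e ^+ 2 * v - p ^+ 2) / (1 + v)) / (2 * sigma ^+ 2) =
   Q / (2 * sigma ^+ 2) + (v * (e / sigma) ^+ 2 + 2 * (e / sigma) * (p / sigma)
     - (p / sigma) ^+ 2) / (2 * (1 + v)).
  by field; rewrite s1 v1.
by rewrite expRD /gauss_gain; ring.
Qed.

Lemma mixture_lt_form t c : 0 < c -> mixture t < c ->
  dotv (S t) (invmx (V t) *m S t) <=
  sigma ^+ 2 * (ln (\det (V t) / ridge ^+ d) + 2 * ln c).
Proof.
move=> c0; set Q := dotv _ _; set D := _ / _ ^+ _ => Mc.
have D0 : 0 < D by rewrite divr_gt0 ?exprn_gt0 ?det_Vmat_gt0.
have sD0 : 0 < Num.sqrt D by rewrite sqrtr_gt0.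
have : Q / (2 * sigma ^+ 2) <= ln c + ln (Num.sqrt D).
  rewrite -lnM ?posrE // -ler_expR lnK ?posrE ?mulr_gt0 //.
  by rewrite -ler_pdivrMr // ltW.
have -> : ln (Num.sqrt D) = ln D / 2.
  rewrite -[in RHS](sqr_sqrtr (ltW D0)) lnXn // mulr2n.
  by field.
have s2 : 0 < 2 * sigma ^+ 2 by rewrite mulr_gt0 // exprn_gt0.
rewrite ler_pdivrMr // => /le_trans; apply.
by rewrite le_eqVlt; apply/orP; left; apply/eqP; field.
Qed.

End SelfNormalized.

Section MeasurableMatrix.
Context (R : realType) (dT : measure_display) (T : measurableType dT) (d : nat).

Definition measurable_mx m n (A : T -> 'M[R]_(m, n)) :=
  forall i j, measurable_fun setT (fun w => A w i j).

Lemma measurable_mulmx m n p (A : T -> 'M[R]_(m, n)) (B : T -> 'M[R]_(n, p)) :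
  measurable_mx A -> measurable_mx B -> measurable_mx (fun w => A w *m B w).
Proof.
move=> mA mB i j; under eq_fun do rewrite mxE.
by apply: measurable_sum => k; exact: measurable_funM.
Qed.

Lemma measurable_trmx m n (A : T -> 'M[R]_(m, n)) :
  measurable_mx A -> measurable_mx (fun w => (A w)^T).
Proof. by move=> mA i j; under eq_fun do rewrite mxE; exact: mA. Qed.

Lemma measurable_dotv (u v : T -> 'cV[R]_d) :
  measurable_mx u -> measurable_mx v ->
  measurable_fun setT (fun w => dotv (u w) (v w)).
Proof.
move=> mu mv; exact: (measurable_mulmx (measurable_trmx mu) mv).
Qed.

End MeasurableMatrix.

Lemma preimage_eq_true (T : Type) (U : eqType) (f : T -> U) c :
  (fun w => f w == c) @^-1` [set true] = f @^-1` [set c].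
Proof. by apply/seteqP; split => w /= /eqP. Qed.

Section Concentration.
Context (R : realType) (dO : measure_display) (Omega : measurableType dO).
Variables (P : probability Omega R) (d N T : nat) (theta : 'I_N -> 'cV[R]_d).
Variables (sigma ridge : R).
Variables (x : nat -> Omega -> 'cV[R]_d) (eta : nat -> 'I_N -> Omega -> R).
Variable (a : nat -> Omega -> 'I_N).
Hypothesis ridge0 : 0 < ridge.
Hypothesis sigma0 : 0 < sigma.
Hypothesis mx : forall t i, (1 <= t <= T)%N -> measurable_fun setT (fun w => x t w i 0).
Hypothesis meta : forall t b, (1 <= t <= T)%N -> measurable_fun setT (eta t b).

Let q t w := qobs theta (fun s => x s w) (fun s b => eta s b w) (fun s => a s w) t.

Hypothesis ma : forall t i, (1 <= t <= T)%N -> hist x q t (a t @^-1` [set i]).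

Lemma hist_mono s t : (s <= t)%N -> hist x q s `<=` hist x q t.
Proof.
move=> st; apply: sub_sigma_algebra2 => A.
case=> [[r [i [B [/andP[r1 rs] mB ->]]]]|[r [B [/andP[r1 rs] mB ->]]]].
  by left; exists r, i, B; split => //; rewrite r1 (leq_trans rs).
by right; exists r, B; split => //; rewrite r1 (leq_trans rs).
Qed.

Lemma measurable_qobs t : (1 <= t <= T)%N -> hist x q t `<=` measurable ->
  measurable_fun setT (q t).
Proof.
move=> tT hm.
have -> : q t = fun w => \sum_b
    (if a t w == b then dotv (theta b) (x t w) + eta t b w else 0).
  apply/funext => w; rewrite (bigD1 (a t w)) //= eqxx big1 ?addr0 // => b ba.
  by rewrite eq_sym (negbTE ba).
apply: measurable_sum => b; apply: measurable_fun_ifT => //.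
- apply: (measurable_fun_bool true); rewrite setTI preimage_eq_true.
  by apply: hm; exact: ma.
- apply: measurable_funD; last exact: meta.
  apply: (@measurable_dotv _ _ _ _ (fun=> theta b)) => i j //.
  by rewrite ord1; exact: mx.
Qed.

Lemma hist_measurable t : (t <= T)%N -> hist x q t `<=` measurable.
Proof.
elim/ltn_ind: t => t IH tT.
apply: smallest_sub; first exact: sigma_algebra_measurable.
move=> A [[r [i [B [/andP[r1 rs] mB ->]]]]|[r [B [/andP[r1 rs] mB ->]]]].
  have := @mx r i; rewrite r1 (leq_trans rs tT) => /(_ isT measurableT B mB).
  by rewrite setTI.
have rT : (1 <= r <= T)%N by rewrite r1 ltnW // (leq_trans rs).
have mqr := measurable_qobs rT (IH r rs (ltnW (leq_trans rs tT))).
have := mqr measurableT B mB.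
by rewrite setTI.
Qed.

Variable b : 'I_N.
Local Notation S t w :=
  (noise_sum (fun s => x s w) (fun s c => eta s c w) (fun s => a s w) b t).
Local Notation V t w := (Vmat ridge (fun s => x s w) (fun s => a s w) b t).
Local Notation W t w :=
  (mixture ridge sigma (fun s => x s w) (fun s c => eta s c w) (fun s => a s w) b t).

Section FixedTime.
Variable t : nat.
Hypothesis tT : (1 <= t <= T)%N.
Local Notation G := (g_sigma_algebraType (hist_gen x q t)).

Lemma hist_x s i : (1 <= s <= t)%N -> measurable_fun [set: G] (fun w => x s w i 0).
Proof.
move=> st _ B mB; rewrite setTI; apply: sub_sigma_algebra.
by left; exists s, i, B.
Qed.

Lemma hist_q s : (1 <= s < t)%N -> measurable_fun [set: G] (q s).
Proof.
move=> st _ B mB; rewrite setTI; apply: sub_sigma_algebra.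
by right; exists s, B.
Qed.

Lemma hist_act s c : (1 <= s <= t)%N -> measurable_fun [set: G] (fun w => a s w == c).
Proof.
move=> /andP[s1 st]; apply: (measurable_fun_bool true); rewrite setTI preimage_eq_true.
apply: (hist_mono st); apply: ma; case/andP: tT => _ tT'.
by rewrite s1 (leq_trans st).
Qed.

(* The noises themselves are not observed, but eta_s b = q_s - <theta_b, x_s>
   whenever b is played at round s. *)
Lemma hist_noise_sum u : (u < t)%N -> measurable_mx (fun w : G => S u.+1 w).
Proof.
elim: u => [|u IH] ut i j.
  by under eq_fun do rewrite /noise_sum big_geq //= mxE; exact: measurable_cst.
have ut' : (1 <= u.+1 <= t)%N by rewrite /= ltnW.
rewrite (_ : (fun w => _) = (fun w => if a u.+1 w == b then S u.+1 w i j
   + (q u.+1 w - dotv (theta b) (x u.+1 w)) * x u.+1 w i 0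
  else S u.+1 w i j)); last first.
  apply/funext => w; rewrite noise_sumS //; case: ifP => // /eqP ab.
  by rewrite /q /qobs ab !mxE (ord1 j); congr (_ + _ * _); lra.
have mS := IH (ltnW ut).
apply: measurable_fun_ifT; [exact: hist_act| |exact: mS].
apply: measurable_funD; first exact: mS.
apply: measurable_funM; last exact: hist_x.
apply: measurable_funB; first exact: hist_q.
apply: (@measurable_dotv _ _ _ _ (fun=> theta b)) => k l //.
by rewrite ord1; exact: hist_x.
Qed.

Lemma hist_x_mx s : (1 <= s <= t)%N -> measurable_mx (fun w : G => x s w).
Proof. by move=> st i j; rewrite ord1; exact: hist_x. Qed.

Lemma hist_invV u : (u < t)%N -> measurable_mx (fun w : G => invmx (V u.+1 w)).
Proof.
elim: u => [|u IH] ut i j.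
  by under eq_fun do rewrite Vmat1 //; exact: measurable_cst.
have ut' : (1 <= u.+1 <= t)%N by rewrite /= ltnW.
have mV := IH (ltnW ut); have mxu := hist_x_mx ut'.
have mVx := measurable_mulmx mV mxu.
have mv := measurable_dotv mxu mVx.
rewrite (_ : (fun w => _) = (fun w => if a u.+1 w == b then invmx (V u.+1 w) i j
   - (1 + dotv (x u.+1 w) (invmx (V u.+1 w) *m x u.+1 w))^-1 *
     ((invmx (V u.+1 w) *m x u.+1 w) *m (invmx (V u.+1 w) *m x u.+1 w)^T) i j
  else invmx (V u.+1 w) i j)); last first.
  apply/funext => w; rewrite VmatS //; case: ifP => // _.
  rewrite invmx_rank1; last exact: posdef_Vmat.
  by rewrite [LHS]mxE; congr (_ + _); rewrite [LHS]mxE [in LHS]mxE.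
apply: measurable_fun_ifT; [exact: hist_act| |exact: mV].
apply: measurable_funB; first exact: mV.
apply: measurable_funM.
  by apply: (measurableT_comp (@measurable_invr R)); exact: measurable_funD.
exact: (measurable_mulmx mVx (measurable_trmx mVx)).
Qed.

Lemma hist_detV u : (u < t)%N -> measurable_fun [set: G] (fun w => \det (V u.+1 w)).
Proof.
elim: u => [|u IH] ut.
  by under eq_fun do rewrite Vmat1 //; exact: measurable_cst.
have ut' : (1 <= u.+1 <= t)%N by rewrite /= ltnW.
have mxu := hist_x_mx ut'.
have mv := measurable_dotv mxu (measurable_mulmx (hist_invV (ltnW ut)) mxu).
rewrite (_ : (fun w => _) = (fun w => if a u.+1 w == b then \det (V u.+1 w)
   * (1 + dotv (x u.+1 w) (invmx (V u.+1 w) *m x u.+1 w))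
  else \det (V u.+1 w))); last first.
  apply/funext => w; rewrite VmatS //; case: ifP => // _.
  by rewrite det_rank1 //; exact/posdef_unit/posdef_Vmat.
apply: measurable_fun_ifT; [exact: hist_act| |exact: (IH (ltnW ut))].
by apply: measurable_funM; [exact: (IH (ltnW ut))|exact: measurable_funD].
Qed.

Lemma hist_mixture u : (u < t)%N -> measurable_fun [set: G] (fun w => W u.+1 w).
Proof.
move=> ut; apply: measurable_funM.
  apply: measurableT_comp => //; apply: measurable_funM => //.
  apply: measurable_dotv; first exact: hist_noise_sum.
  by apply: measurable_mulmx; [exact: hist_invV|exact: hist_noise_sum].
apply: (measurableT_comp (@measurable_invr R)).
apply: (measurableT_comp (@measurable_sqrtr R)).
by apply: measurable_funM => //; exact: hist_detV.
Qed.

End FixedTime.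

Hypothesis subG : forall t c (s : R) (B : set Omega), (1 <= t <= T)%N ->
  hist x q t B ->
  (\int[P]_(w in B) (expR (s * eta t c w))%:E
     <= (expR (s ^+ 2 * sigma ^+ 2 / 2))%:E * P B)%E.

Lemma integral_indicM (D : set Omega) (f : Omega -> R) :
  (\int[P]_(w in D) (f w)%:E = \int[P]_w (\1_D w * f w)%:E)%E.
Proof.
rewrite integral_mkcond epatch_indic; apply: eq_integral => w _ /=.
by rewrite -EFinM mulrC.
Qed.

Lemma mixture_super t A : (1 <= t <= T)%N -> hist x q t A ->
  (\int[P]_(w in A) (W t.+1 w)%:E <= \int[P]_(w in A) (W t w)%:E)%E.
Proof.
move=> tT hA; have /andP[t0 tT'] := tT.
have GGm := hist_measurable tT'.
pose G := g_sigma_algebraType (hist_gen x q t).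
have [u tE] : exists u, t = u.+1 by case: (t) t0 => // u _; exists u.
have ut : (u < t)%N by rewrite tE.
have tt : (1 <= t <= t)%N by rewrite t0 leqnn.
have mxt := hist_x_mx tt.
have mV : measurable_mx (fun w : G => invmx (V t w)).
  by rewrite tE; apply: hist_invV; rewrite -?tE.
have mS : measurable_mx (fun w : G => S t w).
  by rewrite tE; apply: hist_noise_sum; rewrite -?tE.
have mW : measurable_fun [set: G] (fun w => W t w).
  by rewrite tE; apply: hist_mixture; rewrite -?tE.
have mact : measurable_fun [set: G] (fun w => a t w == b) by exact: hist_act.
pose v w := dotv (x t w) (invmx (V t w) *m x t w).
pose m w := dotv (x t w) (invmx (V t w) *m S t w) / sigma.
have mv : measurable_fun [set: G] v.
  by apply: measurable_dotv => //; exact: measurable_mulmx.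
have mm : measurable_fun [set: G] m.
  apply: measurable_funM => //; apply: measurable_dotv => //.
  exact: measurable_mulmx.
pose J w := (a t w == b) && (0 < v w).
have mJ : measurable_fun [set: G] J.
  by apply: measurable_and => //; apply: measurable_fun_ltr.
(* A zero width forces x_t = 0 and leaves the mixture unchanged; only the other
   rounds playing b go through a nondegenerate Gaussian. *)
pose v' w := if J w then v w else 1.
have mv' : measurable_fun [set: G] v' by exact: measurable_fun_ifT.
have v'0 w : 0 < v' w by rewrite /v'; case: ifP => // /andP[].
have mA : measurable_fun [set: G] (\1_A : Omega -> R) by exact: measurable_indic.
pose f1 w := \1_A w * (if J w then W t w else 0).
pose f2 w := \1_A w * (if J w then 0 else W t w).
have mf1 : measurable_fun [set: G] f1.
  by apply: measurable_funM => //; exact: measurable_fun_ifT.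
have mf2 : measurable_fun [set: G] f2.
  by apply: measurable_funM => //; exact: measurable_fun_ifT.
have f10 w : 0 <= f1 w.
  by rewrite /f1 mulr_ge0 ?indicE //; case: ifP => // _; exact: mixture_ge0.
have f20 w : 0 <= f2 w.
  by rewrite /f2 mulr_ge0 ?indicE //; case: ifP => // _; exact: mixture_ge0.
have E1 w : \1_A w * W t.+1 w = f1 w * gauss_gain (m w) (v' w) (eta t b w / sigma) + f2 w.
  rewrite mixtureS // /f1 /f2 /v'; have [Jw|] := boolP (J w).
    by rewrite !mulr0 addr0 -mulrA; case/andP: Jw => ->.
  rewrite /J !mulr0 mul0r add0r negb_and -leNgt; case: eqVneq => //= _ vw.
  suff -> : x t w = 0.
    rewrite mulmx0 dotv0r dotvC dotv0r mul0r /gauss_gain expr0n /=.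
    by rewrite !(mul0r, mulr0, addr0, subr0, expR0, sqrtr1, invr1, mulr1).
  apply: contraTeq vw => x0; rewrite -ltNge.
  by apply: (posdef_inv (posdef_Vmat _ _ _ ridge0 t)).2.
have E2 w : \1_A w * W t w = f1 w + f2 w.
  by rewrite /f1 /f2; case: ifP => _; rewrite mulr0 ?addr0 ?add0r.
have mf1O := measurable_fun_sub GGm mf1.
have mf2O := measurable_fun_sub GGm mf2.
have mgain : measurable_fun setT (fun w => gauss_gain (m w) (v' w) (eta t b w / sigma)).
  apply: measurable_gauss_gain.
  - exact: measurable_fun_sub mm.
  - exact: measurable_fun_sub mv'.
  - by apply: measurable_funM => //; exact: meta.
rewrite [leLHS]integral_indicM [leRHS]integral_indicM.
under eq_integral do rewrite E1 EFinD.
under [leRHS]eq_integral do rewrite E2 EFinD.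
have intD (g : Omega -> R) : measurable_fun setT g -> (forall w, 0 <= g w) ->
    (\int[P]_w ((g w)%:E + (f2 w)%:E) = \int[P]_w (g w)%:E + \int[P]_w (f2 w)%:E)%E.
  move=> mg g0; apply: ge0_integralD => //; try by move=> w _; rewrite lee_fin.
    exact/measurable_EFinP.
  exact/measurable_EFinP.
rewrite !intD //; last 2 first.
- exact: measurable_funM.
- by move=> w; rewrite mulr_ge0 // gauss_gain_ge0.
apply: leeD => //.
apply: (gauss_gain_cond_le GGm (eta := fun w => eta t b w / sigma)) => //.
  by apply: measurable_funM => //; exact: meta.
move=> s B hB; have := subG b (s / sigma) tT hB.
have -> : (s / sigma) ^+ 2 * sigma ^+ 2 = s ^+ 2 by field; rewrite gt_eqF.
by under eq_integral do rewrite mulrAC -mulrA.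
Qed.

Lemma mixture_maximal c : 0 < c -> exists F : set Omega,
  [/\ measurable F, (P F <= (c^-1)%:E)%E &
   forall w, ~ F w -> forall t, (1 <= t <= T)%N -> W t w < c].
Proof.
move=> c0; have [T0|T0] := posnP T.
  exists set0; split => //; first by rewrite measure0 lee_fin invr_ge0 ltW.
  by move=> w _ t; rewrite T0; case: t.
have tT1 t : (t <= T.-1)%N -> (1 <= t.+1 <= T)%N.
  by move=> tn /=; rewrite -(prednK T0).
pose Wn k w := W k.+1 w.
have mWG k : (k <= T.-1)%N ->
    measurable_fun [set: g_sigma_algebraType (hist_gen x q k.+1)] (Wn k).
  by move=> kT; apply: hist_mixture => //; exact: tT1.
have mWn k : (k <= T.-1)%N -> measurable_fun setT (Wn k).
  move=> kT; apply: measurable_fun_sub (mWG k kT).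
  by apply: hist_measurable; case/andP: (tT1 _ kT).
have Wn0 k w : 0 <= Wn k w by exact: mixture_ge0.
exists (~` alive Wn c T.-1); split.
- by apply: measurableC; exact: (measurable_alive c mWn (leqnn _)).
- rewrite -(@lee_pmul2l _ c%:E) // -EFinM divff ?gt_eqF //.
  have -> : 1%:E = (\int[P]_w (Wn 0 w)%:E)%E.
    under eq_integral do rewrite /Wn mixture1 //.
    by rewrite (integral_cst P _ 1%:E) // mul1e [RHS]probability_setT.
  apply: (ville_maximal c0 mWn Wn0) => k kT.
  apply: mixture_super; first by apply: tT1; exact: ltnW.
  have mWk s : (s <= k)%N ->
      measurable_fun [set: g_sigma_algebraType (hist_gen x q k.+1)] (Wn s).
    by move=> sk; apply: hist_mixture => //; apply: tT1; exact: ltnW.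
  exact: (measurable_alive c mWk (leqnn k)).
- move=> w /contrapT al t tT; have /andP[t0 _] := tT.
  rewrite -(prednK t0); apply: al; rewrite -ltnS (prednK t0) (prednK T0).
  by case/andP: tT.
Qed.

End Concentration.

Lemma measure_bigsetU_le (R : realType) (dO : measure_display)
    (Omega : measurableType dO) (P : probability Omega R) (I : Type) (s : seq I)
    (F : I -> set Omega) : (forall i, measurable (F i)) ->
  measurable (\big[setU/set0]_(i <- s) F i) /\
  (P (\big[setU/set0]_(i <- s) F i) <= \sum_(i <- s) P (F i))%E.
Proof.
move=> mF; elim: s => [|i s [ms Ps]]; first by rewrite !big_nil measure0.
rewrite !big_cons; split; first exact: measurableU.
by apply: le_trans (measureU2 _ _ _) _ => //; exact: leeD2l.
Qed.

Theorem theorem4p1 (R : realType) (dO : measure_display) (Omega : measurableType dO)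
  (P : probability Omega R)
  (d N K T H : nat) (theta : 'I_N -> 'cV[R]_d) (lam : 'I_N -> R)
  (alpha gamma sigma ridge delta : R)
  (x : nat -> Omega -> 'cV[R]_d) (eta : nat -> 'I_N -> Omega -> R)
  (a : nat -> Omega -> 'I_N) (C : nat -> Omega -> {set 'I_N}) :
  (1 <= K <= N)%N -> (0 < H)%N ->
  0 < alpha -> 0 < gamma -> 0 < sigma -> 1 <= ridge -> 0 < delta < 1 ->
  (forall b, 0 < lam b) ->
  (forall b, dotv (theta b) (theta b) <= 1) ->
  (forall t w, (1 <= t <= T)%N -> dotv (x t w) (x t w) <= 1) ->
  (forall t i, (1 <= t <= T)%N -> measurable_fun setT (fun w => x t w i 0)) ->
  (forall t b, (1 <= t <= T)%N -> measurable_fun setT (eta t b)) ->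
  let q := fun t w => qobs theta (fun s => x s w) (fun s b => eta s b w)
                           (fun s => a s w) t in
  (* the action chosen at round t depends only on the history G_t *)
  (forall t i, (1 <= t <= T)%N -> hist x q t (a t @^-1` [set i])) ->
  (* eta_t(b) is conditionally sigma-sub-Gaussian given G_t *)
  (forall t b (s : R) (B : set Omega), (1 <= t <= T)%N -> hist x q t B ->
     (\int[P]_(w in B) (expR (s * eta t b w))%:E
        <= (expR (s ^+ 2 * sigma ^+ 2 / 2))%:E * P B)%E) ->
  (* POLAR: initial cache *)
  (forall w, #|C 1%N w| <= K)%N ->
  (* POLAR: greedy cache updates at the start of epochs l >= 2 *)
  (forall w l, (2 <= l <= nepochs T H)%N ->
     greedy_update sigma ridge delta alpha gamma lam K H
       (fun s => x s w) (fun s => q s w) (fun s => a s w) (C l.-1 w) l (C l w)) ->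
  (* POLAR: a_t maximizes the cache-aware score *)
  (forall w t, (1 <= t <= T)%N -> forall b,
     score sigma ridge delta alpha lam H (fun s => x s w) (fun s => q s w)
       (fun s => a s w) (fun l => C l w) t b
     <= score sigma ridge delta alpha lam H (fun s => x s w) (fun s => q s w)
       (fun s => a s w) (fun l => C l w) t (a t w)) ->
  exists E : set Omega,
    [/\ measurable E, ((1 - delta)%:E <= P E)%E &
     forall w, E w ->
       regret theta lam alpha gamma K T H (fun t => x t w) (fun t => a t w)
         (fun l => C l w)
       <= 2 * beta d N sigma ridge delta T
            * Num.sqrt (2 * N%:R * d%:R * T%:R * ln (1 + T%:R / (d%:R * ridge)))
          + alpha * fmax predT lam * T%:R
          + (nepochs T H)%:R * K%:R * gamma].
Proof.
move=> KN H0 alpha0 gamma0 sigma0 ridge1 /andP[delta0 delta1] lam0 theta1 x1 mx meta q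
  ma subG _ greedyC greedyA.
have ridge0 := lt_le_trans ltr01 ridge1.
have N0 : (0 < N)%N by case/andP: KN => K0; exact: leq_trans.
have N0R : 0 < N%:R :> R by rewrite ltr0n.
have c0 : 0 < N%:R / delta by rewrite divr_gt0.
have c1 : 1 <= N%:R / delta.
  by rewrite ler_pdivlMr // mul1r (le_trans (ltW delta1)) // ler1n.
have /choice[F HF] b := mixture_maximal ridge0 sigma0 mx meta ma b subG c0.
have mF b : measurable (F b) by have [] := HF b.
have [mU PU] := measure_bigsetU_le P (enum 'I_N) mF.
exists (~` \big[setU/set0]_(b <- enum 'I_N) F b); split.
- exact: measurableC.
- rewrite probability_setC // EFinB leeB //; apply: le_trans PU _.
  apply: (@le_trans _ _ (\sum_(b <- enum 'I_N) (delta / N%:R)%:E)%E).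
    apply: lee_sum => b _; have [_ PF _] := HF b; apply: le_trans PF _.
    by rewrite invf_div.
  rewrite big_enum /= sumEFin lee_fin sumr_const card_ord -[leLHS]mulr_natr.
  by rewrite divfK // gt_eqF.
move=> w Ew.
have goodw b t : (1 <= t <= T)%N -> mixture ridge sigma (fun s => x s w)
    (fun s c => eta s c w) (fun s => a s w) b t < N%:R / delta.
  have [_ _ Hb] := HF b; apply: Hb => Fb; apply: Ew.
  by rewrite -bigcup_seq; exists b => //=; rewrite mem_enum.
apply: regret_le => //.
- by move=> t tT; exact: x1.
- move=> b t tT; apply: le_trans (mixture_lt_form ridge0 sigma0 c0 (goodw b t tT)) _.
  rewrite ler_wpM2l ?sqr_ge0 // lerD2r.
  apply: le_trans (ln_det_Vmat_le _ _ ridge0 _) _.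
    move=> s /andP[s1 st]; apply: x1; rewrite s1 (leq_trans (ltnW st)) //.
    by case/andP: tT.
  rewrite ler_wpM2l //.
  by have /andP[] := log1D_le d ridge1 (leq_pred t).
- by move=> t tT b; exact: greedyA.
- by move=> l lT; have := greedyC w l lT => /greedy_card; rewrite cards0.
Qed.
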